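(* Let $X_{it}=\sigma_{it}Z_{it}$, $i,t\ge 1$, be the stochastic volatility model described in the context, and let $\mathbf X=\mathbf X_n=(X_{it})_{i=1,\ldots,p;\,t=1,\ldots,n}$ and $\mathbf S=\mathbf X\mathbf X'$. Assume the following. (1) $p=p_n\to\infty$ is an integer sequence of the form $p_n=n^{\beta}\ell(n)$, $n\ge 1$, where $\ell$ is a slowly varying function and $\beta\in(0,1]$. (2) For some $\alpha\in(0,2)\cup(2,4)$, constants $q_+,q_-\ge 0$ with $q_++q_-=1$ and a slowly varying function $L$, one has $\mathbb P(Z>x)\sim q_+L(x)x^{-\alpha}$ and $\mathbb P(Z<-x)\sim q_-L(x)x^{-\alpha}$ as $x\to\infty$; moreover $\mathbb E[Z]=0$ if $\mathbb E[|Z|]<\infty$. (3) $\mathbb E[\sigma^r]<\infty$ for all $r>0$. Then $$a_{np}^{-2}\,\|\mathbf S-\operatorname{diag}(\mathbf S)\|_2\stackrel{\mathbb P}{\rightarrow}0,\qquad n\to\infty.$$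
   Context: Stochastic volatility model: $(Z_{it})_{i,t\ge1}$ is a field of iid real random variables, $(\sigma_{it})_{i,t\ge 1}$ is a strictly stationary random field of non-negative random variables, the fields $(\sigma_{it})$ and $(Z_{it})$ are independent, and $X_{it}=\sigma_{it}Z_{it}$. $X,\sigma,Z$ denote generic elements of the respective fields. $(a_k)$ is a sequence of positive numbers with $k\,\mathbb P(|Z|>a_k)\to 1$ as $k\to\infty$, and $a_{np}$ is its element with index $k=np$, $p=p_n$. $\|\mathbf C\|_2$ denotes the spectral norm (largest singular value) of a matrix $\mathbf C$; $\operatorname{diag}(\mathbf C)$ denotes the diagonal matrix with the same diagonal as $\mathbf C$. *)

(* Defs.v *)
From HB Require Import structures.
From mathcomp Require Import all_boot all_order all_algebra.
From mathcomp Require Import finmap.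
From mathcomp Require Import all_classical all_reals all_analysis.

Set Implicit Arguments.
Unset Strict Implicit.
Unset Printing Implicit Defensive.
Import Order.TTheory GRing.Theory Num.Theory.
Import numFieldNormedType.Exports.
Local Open Scope classical_set_scope.
Local Open Scope ring_scope.

(* A random field indexed by pairs (i, t) of integers with i, t >= 1 is
   represented by [Y : nat -> nat -> {RV P >-> R}] with indices starting at 0:
   [Y i t] stands for the variable with index (i + 1, t + 1).  In particular
   [Y 0 0] is used as the generic element of a field whose elements all have
   the same distribution. *)

Section RandomFields.
Context {d : measure_display} {T : measurableType d} {R : realType}.
Variable P : probability T R.
Implicit Types Y W : nat -> nat -> {RV P >-> R}.

Definition mutually_independent Y : Prop :=
  forall (J : {fset nat * nat}) (B : nat * nat -> set R),
    (forall j, j \in J -> measurable (B j)) ->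
    P (\bigcap_(j in [set` J]) (Y j.1 j.2 @^-1` B j)) =
    (\prod_(j <- J) P (Y j.1 j.2 @^-1` B j))%E.

Definition identically_distributed Y : Prop :=
  forall (i t : nat) (B : set R), measurable B ->
    distribution P (Y i t) B = distribution P (Y 0%N 0%N) B.

Definition iid_field Y : Prop :=
  mutually_independent Y /\ identically_distributed Y.

Definition field_tuple Y (m : nat) (I : m.-tuple (nat * nat)) (w : T)
  : m.-tuple R := [tuple Y (tnth I j).1 (tnth I j).2 w | j < m].

(* Finite-dimensional distributions are invariant under translation of the
   indices; [B] is a Borel set of R^m. *)
Definition strictly_stationary Y : Prop :=
  forall (h k m : nat) (I : m.-tuple (nat * nat)) (B : set (m.-tuple R)),
    measurable B ->
    P (field_tuple Y [tuple ((tnth I j).1 + h, (tnth I j).2 + k)%N | j < m]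
         @^-1` B) =
    P (field_tuple Y I @^-1` B).

Definition sigma_field Y : set (set T) :=
  <<s [set A | exists i t (B : set R), measurable B /\ A = Y i t @^-1` B] >>.

Definition independent_fields Y W : Prop :=
  forall A B : set T, sigma_field Y A -> sigma_field W B ->
    P (A `&` B) = (P A * P B)%E.

Definition cvg_in_probability (V : nat -> T -> R) (c : R) : Prop :=
  forall e : R, 0 < e -> P [set w | e < `|V n w - c|] @[n --> \oo] --> 0%E.

End RandomFields.

Definition slowly_varying {R : realType} (L : R -> R) : Prop :=
  (exists x0 : R, measurable_fun `[x0, +oo[ L /\
     (forall x, x0 <= x -> 0 < L x)) /\
  (forall c : R, 0 < c -> L (c * x) / L x @[x --> +oo] --> (1 : R)).

(* The largest singular value: the singular values of [C] are the square roots
   of the eigenvalues of [C^T *m C].  The value is 0 when [C] has no column. *)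
Definition spectral_norm {R : realType} (m n : nat) (C : 'M[R]_(m, n)) : R :=
  sup [set Num.sqrt l | l in [set l : R | eigenvalue (C^T *m C) l]].

Definition diag_part {R : realType} (n : nat) (C : 'M[R]_n) : 'M[R]_n :=
  diag_mx (\row_i C i i).

Definition sv_matrix {T : Type} {R : realType} (sigma Z : nat -> nat -> T -> R)
    (p n : nat) (w : T) : 'M[R]_(p, n) :=
  \matrix_(i < p, t < n) (sigma i t w * Z i t w).

(* Main.v *)
Require Import Defs.
From HB Require Import structures.
From mathcomp Require Import all_boot all_order all_algebra.
From mathcomp Require Import finmap.
From mathcomp Require Import all_classical all_reals all_analysis.
From mathcomp Require Import measurable_realfun.
From mathcomp Require complex.
From mathcomp Require Import ring lra.

Set Implicit Arguments.
Unset Strict Implicit.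
Unset Printing Implicit Defensive.
Import Order.TTheory GRing.Theory Num.Theory.
Import numFieldNormedType.Exports.
Local Open Scope classical_set_scope.
Local Open Scope ring_scope.

(** Let [N = n p], let [A] be the off-diagonal part of [S] and write [||A||] for
its spectral norm.  Since [A] is symmetric, [||A||^K <= tr A^K] for even [K], so
by Markov's inequality it is enough to bound [E (tr A^K)] by [o(a_N^(2K))] for
one fixed, large [K].  There is polynomial room: [a_N] exceeds [N^r] for every
[r < 1/alpha], while a bounded noise would give [||A||] of order [N^(1/2)] up to
small powers, and [1/2 < 2/alpha].  So slowly varying functions only enter
through the bounds [x^(-e) <= L x <= x^e] ([slowly_varying_bounds]), and powers
[N^eta] may be wasted as long as [eta] is small compared with [1/K].

Truncate the noise at [b = N^s] with [s] slightly above [1/alpha]: with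
probability tending to one no [|Z_it|] exceeds [b], and then the truncated
variables [U_it] give the same matrix.  The trace of [A^K] is a sum over closed
walks that alternate between rows and columns of the data matrix, never returning
from a column to the row they came from; a walk contributes the product of the
entries on its [2K] edges.  The volatilities contribute at most a moment of
[sigma], whatever their dependence, because the two fields are independent and a
product is dominated by a sum of powers; thus no conditioning is required.  The
noise contributes, by independence, a product over the distinct edges of
[E U^m], [m] being the multiplicity of the edge.

Two facts balance each other.  First ([truncated_moments],
[moment_gain_bounds]), [N^(1/2) |E U^m|] is at most a constant times [b^m] times
a gain: the gain is [N^(-dl)] for some [dl > 0], and [N^(-1/2)] when [m = 1],
by centering, and when [m >= 4].  Secondly ([sum_walks_distinct_edges]), walks
weighted by [q] for each distinct edge, with [q] close to [N^(-1/2)], have total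
weight [O(p)].  Indeed a column visited for the first time brings two new edges
and costs at most [n p] choices, which is about [q^(-2)]; a new row reached
through an old column brings one new edge and costs [p] choices, which is at
most [q^(-1)] because [p <= n^(1+eta)].

There remains the factor [p], about [N^(1/2)] at most, which the gains beat
([prod_edge_gain]): either there are so many distinct edges that their gains
multiply to less than [N^(-1)], or there are few of them, and then, [K] being
large, one edge has multiplicity at least four and gains [N^(-1/2)], while a
second edge, always present, gains [N^(-dl)].

The event that the norm is large has to be measurable for these estimates to make
sense; this holds since [||C|| <= x] amounts to the countably many polynomial
inequalities [tr ((C^T C)^k) <= n x^(2k)] ([spectral_norm_leP]). *)

(** * Slowly varying functions *)

Section SlowVariation.
Variable R : realType.
Implicit Types (h L : R -> R) (A : set R).
Local Notation mu := (@lebesgue_measure R).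

Lemma lebesgue_measure_shift (c : R) A : measurable A ->
  mu ((fun x : R => x + c) @^-1` A) = mu A.
Proof.
move=> mA.
have mc : measurable_fun [set: measurableTypeR R]
    (fun x : measurableTypeR R => (x + c : measurableTypeR R)).
  by apply: measurable_funD => //; exact: measurable_cst.
rewrite -[LHS]/(pushforward mu
  (fun x : measurableTypeR R => (x + c : measurableTypeR R)) A).
apply/esym/lebesgue_measure_unique => //= _ [[a b]] _ <-.
rewrite /pushforward /=.
have -> : (fun x : R => x + c) @^-1` `]a, b] = `]a - c, b - c]%classic :> set R.
  by apply/seteqP; split => x /=; rewrite !in_itv/= ltrBlDr lerBrDr.
rewrite !lebesgue_measure_itv/= !lte_fin ltrD2r.
by case: ifP => // _; rewrite -!EFinB; congr (_%:E); ring.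
Qed.

(** The [u] whose increments have settled from the index [m] on.  For fixed [h] with
vanishing increments these sets exhaust [[0, 2]] as [m] grows, which turns
pointwise convergence into a statement about measure. *)
Definition stable_increments h (y : nat -> R) (m : nat) : set R :=
  `[0, 2] `&` \bigcap_(n in [set n | (m <= n)%N])
     [set u | `|h (y n + u) - h (y n)| < 1 / 2].

Lemma measurable_stable_increments h y m : measurable_fun setT h ->
  measurable (stable_increments h y m).
Proof.
move=> mh; apply: measurableI => //.
apply: bigcap_measurable; first by exists m => /=.
move=> n _.
have mf : measurable_fun setT (fun u => `|h (y n + u) - h (y n)|).
  apply: measurableT_comp => //; apply: measurable_funB => //.
  apply: measurableT_comp => //; exact: measurable_funD.
rewrite (_ : [set _ | _] =
  (fun u => `|h (y n + u) - h (y n)|) @^-1` `]-oo, (1 / 2)[); last first.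
  by apply/seteqP; split => u /=; rewrite in_itv.
by rewrite -[X in measurable X]setTI; exact: mf.
Qed.

Lemma stable_increments_large h y : measurable_fun setT h ->
  (forall u, h (x + u) - h x @[x --> +oo] --> (0 : R)) ->
  y n @[n --> \oo] --> +oo ->
  \forall m \near \oo, ((3 / 2)%:E < mu (stable_increments h y m))%E.
Proof.
move=> mh h0 yoo.
have UE : \bigcup_n stable_increments h y n = `[0, 2]%classic.
  apply/seteqP; split => [u [n _ []]//|u u02].
  have := cvg_comp _ _ yoo (h0 u) => /cvgrPdist_lt/(_ (1/2)).
  have : (0 < 1/2 :> R) by lra.
  move=> /[swap]/[apply] -[m _ Hm]; exists m => //; split => // n /= mn.
  by have := Hm n mn; rewrite /= sub0r normrN.
have mu2 : mu `[0%R, 2%R] = 2%:E.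
  by rewrite lebesgue_measure_itv/= lte_fin ltr0n /= -EFinB subr0.
have H : mu \o (stable_increments h y) @ \oo --> 2%:E.
  rewrite -mu2 -UE; apply: nondecreasing_cvg_mu => //.
  - by move=> m; exact: measurable_stable_increments.
  - by rewrite UE.
  move=> n m nm; apply/subsetPset => u [u02 H]; split => // k /= mk.
  by apply: H => /=; exact: leq_trans mk.
apply: (H [set x | ((3 / 2)%:E < x)%E]).
by apply: (@nbhs_open_ereal_gt _ 2 (fun=> 3 / 2)); lra.
Qed.


(** Suppose the bound fails at points [x_n], [x_n + u_n] with [0 <= u_n <= 1] and
[x_n] tending to infinity.  For large [m] the increments from [x_m] and those from
[x_m + u_m] are below [1/2] on subsets of [[0, 2]] of measure above [3/2].  After
shifting the second set by [u_m] both lie in [[0, 3]], so they meet, and a common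
point joins [h (x_m)] to [h (x_m + u_m)] in two steps below [1/2]. *)
Lemma increments_unif_bounded h : measurable_fun setT h ->
  (forall u, h (x + u) - h x @[x --> +oo] --> (0 : R)) ->
  exists X, forall x u, X <= x -> 0 <= u <= 1 -> `|h (x + u) - h x| <= 1.
Proof.
move=> mh h0; apply: contrapT => nH.
have [n|f Hf] := @choice nat (R * R)%type (fun n f => [/\ n%:R <= f.1,
    0 <= f.2 <= 1 & 1 < `|h (f.1 + f.2) - h f.1|]).
  apply: contrapT => nHn; apply: nH; exists n%:R => x u nx u01.
  by rewrite leNgt; apply/negP => H; apply: nHn; exists (x, u).
pose x n := (f n).1; pose u n := (f n).2; pose xu n := x n + u n.
have xoo : x n @[n --> \oo] --> +oo.
  apply/cvgryPge => A; near=> n; have [+ _ _] := Hf n; apply: le_trans.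
  by near: n; exact: nbhs_infty_ger.
have xuoo : xu n @[n --> \oo] --> +oo.
  apply/cvgryPge => A; near=> n; have [_ /andP[un0 _] _] := Hf n.
  by rewrite /xu -[A]addr0; apply: lerD => //; near: n; move/cvgryPge: xoo; exact.
near \oo => m.
have mU := measurable_stable_increments x m mh.
have mV := measurable_stable_increments xu m mh.
have U32 : ((3 / 2)%:E < mu (stable_increments h x m))%E.
  by near: m; exact: stable_increments_large.
have V32 : ((3 / 2)%:E < mu (stable_increments h xu m))%E.
  by near: m; exact: stable_increments_large.
have [_ /andP[um0 um1] hm] := Hf m.
rewrite -/(x m) -/(u m) -/(xu m) in um0 um1 hm.
move: mU mV U32 V32; set U := stable_increments _ _ _.
set V := stable_increments _ _ _ => mU mV U32 V32.
(* Shifted by [u m], the second set also consists of increments from [x m]. *)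
pose V' := (fun z : R => z + - u m) @^-1` V.
have mV' : measurable V'.
  have mc : measurable_fun setT (fun z : R => z + - u m) by exact: measurable_funD.
  by rewrite -[V']setTI; exact: mc.
have V'32 : ((3 / 2)%:E < mu V')%E by rewrite lebesgue_measure_shift.
have UV0 : U `&` V' = set0.
  apply/seteqP; split => // z [[z02 Uz] [zu02 Vz]].
  have := Uz m (leqnn m); have := Vz m (leqnn m); rewrite /=.
  have -> : xu m + (z - u m) = x m + z by rewrite /xu; ring.
  move: hm; move: (h _) (h (x m)) (h (x m + z)) => a b c.
  rewrite ltr_normr => H; rewrite !ltr_norml => /andP[? ?] /andP[? ?].
  by case/orP: H => ?; lra.
have : (mu (U `|` V') <= mu `[0%R, 3%R]%classic)%E.
  apply: le_measure; rewrite ?inE//; first exact: measurableU.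
  move=> z [[]|[]]; rewrite /= !in_itv/= => /andP[? ?] _; apply/andP; split; lra.
rewrite measureU// lebesgue_measure_itv/= lte_fin ltr0n /= -EFinB subr0.
apply/negP; rewrite -ltNge.
by apply: le_lt_trans (lteD U32 V'32); rewrite -EFinD lee_fin; lra.
Unshelve. all: by end_near. Qed.

(** Far out a unit step changes [h] by at most [e/2] and a fractional step by at most
[1]; hence [h] is bounded by a line of slope [e/2], whose constant is eventually
absorbed by the other half of the slope. *)
Lemma increments_sublinear h (e : R) : 0 < e -> measurable_fun setT h ->
  (forall u, h (x + u) - h x @[x --> +oo] --> (0 : R)) ->
  exists Y, forall y, Y <= y -> `|h y| <= e * y.
Proof.
move=> e0 mh h0.
have [X1 HX1] := increments_unif_bounded mh h0.
have [X2 [_ HX2]] : \forall x \near +oo, `|h (x + 1) - h x| < e / 2.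
  have := h0 1 => /cvgrPdist_lt/(_ (e / 2)); have : 0 < e / 2 by lra.
  by move=> /[swap]/[apply]; apply: filterS => x; rewrite sub0r normrN.
(* The bound near [X2] is strict, hence the shift by one. *)
pose X := Num.max 0 (Num.max X1 (X2 + 1)).
have [X0 X1X X2X] : [/\ 0 <= X, X1 <= X & X2 + 1 <= X].
  by rewrite /X !le_max !lexx !orbT.
pose C := `|h X| + 1.
have growth (k : nat) u : 0 <= u <= 1 -> `|h (X + u + k%:R)| <= C + e / 2 * k%:R.
  move=> u01; elim: k => [|k IH].
    rewrite addr0 mulr0 addr0 /C -[h (X + u)](subrK (h X)).
    by apply: (le_trans (ler_normD _ _)); rewrite addrC lerD2l; exact: HX1.
  rewrite -natr1 addrA -[h (_ + 1)](subrK (h (X + u + k%:R))).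
  apply: (le_trans (ler_normD _ _)).
  have kR : 0 <= k%:R :> R by [].
  have : `|h (X + u + k%:R + 1) - h (X + u + k%:R)| < e / 2.
    by apply: HX2; lra.
  by move: IH; lra.
exists (X + 2 * C / e) => y yX.
have C0 : 0 <= C by rewrite addr_ge0.
have Ce : 0 <= 2 * C / e by rewrite divr_ge0 ?mulr_ge0// ltW.
have yX0 : 0 <= y - X by lra.
pose k := Num.truncn (y - X).
have /andP[k1 k2] := truncn_itv yX0.
have u01 : 0 <= y - X - k%:R <= 1.
  by rewrite -/k -natr1 in k1 k2 *; apply/andP; split; lra.
have := growth k _ u01.
have -> : X + (y - X - k%:R) + k%:R = y by ring.
move=> /le_trans; apply.
have : e / 2 * k%:R <= e / 2 * y by rewrite ler_pM2l ?divr_gt0//; rewrite -/k in k1; lra.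
have : 2 * C <= e * y.
  by rewrite -ler_pdivrMl// mulrC; lra.
lra.
Qed.

(** In logarithmic coordinates, [h y = ln (L (exp y))] has vanishing increments, so
it grows more slowly than any linear function. *)
Lemma slowly_varying_bounds L (e : R) : slowly_varying L -> 0 < e ->
  \forall x \near +oo, x `^ (- e) <= L x <= x `^ e.
Proof.
move=> [[x0 [mL L0]] svL] e0.
(* Restricting [L] makes [h] measurable on the whole line without changing it far out. *)
pose h y := ln ((L \_ `[x0, +oo[) (expR y)).
have expRoo : expR x @[x --> +oo] --> (+oo : set_system R).
  apply/cvgryPge => A; near=> x; apply: le_trans _ (expR_ge1Dx x).
  by rewrite -lerBlDl; near: x; exact: nbhs_pinfty_ge (num_real _).
have expoo : \forall y \near +oo, x0 <= expR y.
  by move/cvgryPge: expRoo; exact.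
have hE y : x0 <= expR y -> h y = ln (L (expR y)).
  by move=> xy; rewrite /h patchE ifT// inE/= in_itv/= xy.
have mh : measurable_fun setT h.
  apply: (measurableT_comp (@measurable_ln R)).
  apply: (@measurableT_comp _ _ _ _ _ _ (L \_ `[x0, +oo[)); last exact: measurable_expR.
  by apply/(measurable_restrictT L (measurable_itv `[x0, +oo[)).
have h0 u : h (x + u) - h x @[x --> +oo] --> (0 : R).
  have c1 : L (expR u * expR x) / L (expR x) @[x --> +oo] --> (1 : R).
    exact: (cvg_comp _ _ expRoo (svL _ (expR_gt0 u))).
  have : ln (L (expR u * expR x) / L (expR x)) @[x --> +oo] --> (ln 1 : R).
    by apply: continuous_cvg => //; exact: continuous_ln.
  rewrite ln1; apply: cvg_trans; apply: near_eq_cvg.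
  have [Y [_ HY]] := expoo.
  near=> x.
  have xY : Y < x by near: x; exact: nbhs_pinfty_gt (num_real _).
  have xuY : Y < x + u by rewrite -ltrBlDr; near: x; exact: nbhs_pinfty_gt (num_real _).
  have Lx : 0 < L (expR x) by apply: L0; exact: HY.
  have Lxu : 0 < L (expR (x + u)) by apply: L0; exact: HY.
  rewrite !hE; [|exact: HY|exact: HY].
  by rewrite -expRD [u + x]addrC lnM ?posrE ?invr_gt0// lnV ?posrE.
have [Y HY] := increments_sublinear e0 mh h0.
near=> x.
have x1 : 0 < x by near: x; exact: nbhs_pinfty_gt (num_real _).
have xx0 : x0 <= x by near: x; exact: nbhs_pinfty_ge (num_real _).
have xY : Y <= ln x.
  by rewrite -[Y]expRK ler_ln ?posrE ?expR_gt0//; near: x; exact: nbhs_pinfty_ge (num_real _).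
have := HY _ xY; rewrite hE lnK ?posrE// ler_norml => /andP[h1 h2].
rewrite /powR gt_eqF//.
have Lx : 0 < L x by exact: L0.
by rewrite -[L x]lnK ?posrE// !ler_expR mulNr h1 h2.
Unshelve. all: by end_near. Qed.

End SlowVariation.

(** * Powers and regularly varying tails *)

Section PowerBounds.
Variable R : realType.

Lemma powR_eventually_ge (c e : R) : 0 < e -> \forall x \near +oo, c <= x `^ e.
Proof.
move=> e0; near=> x.
have cx : `|c| `^ e^-1 <= x by near: x; exact: nbhs_pinfty_ge (num_real _).
apply: (le_trans (ler_norm c)).
rewrite -[leLHS]powRr1// -(mulVf (lt0r_neq0 e0)) powRrM.
by apply: ge0_ler_powR; rewrite ?nnegrE ?powR_ge0// ?(ltW e0)// (le_trans _ cx)// powR_ge0.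
Unshelve. all: by end_near. Qed.

Lemma near_natr (Q : R -> Prop) : (\forall x \near +oo, Q x) ->
  \forall n \near \oo, Q n%:R.
Proof. by move=> H; exact: (@cvgr_idn R). Qed.

(** This is how the growth condition on the dimension is used: up to a small power,
[p] is at most [n]. *)
Lemma slowly_varying_growth (p : nat -> nat) (beta e : R) (ell : R -> R) :
  beta <= 1 -> slowly_varying ell ->
  (forall n, (0 < n)%N -> (p n)%:R = n%:R `^ beta * ell n%:R) ->
  0 < e -> \forall n \near \oo, (p n)%:R <= n%:R `^ (1 + e) :> R.
Proof.
move=> beta1 svl pE e0.
have H := near_natr (slowly_varying_bounds svl e0).
near=> n.
have n1 : (0 < n)%N by near: n; exact: nbhs_infty_gt.
have n1R : 1 <= n%:R :> R by rewrite ler1n.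
have /andP[_ le] : n%:R `^ (- e) <= ell n%:R <= n%:R `^ e by near: n.
rewrite pE// powRD; last by apply/implyP => _; rewrite gt_eqF// (lt_le_trans _ n1R).
apply: (le_trans (ler_wpM2l (powR_ge0 _ _) le)).
by apply: ler_wpM2r; rewrite ?powR_ge0// ler_powR.
Unshelve. all: by end_near. Qed.

End PowerBounds.

Section Tails.
Context d (T : measurableType d) (R : realType) (P : probability T R).
Variable Z : {RV P >-> R}.

Definition abs_tail (x : R) : R := fine (P [set w | x < `|Z w|]).

Lemma measurable_abs_gt x : measurable [set w | x < `|Z w|].
Proof.
have mZ : measurable_fun setT (fun w => `|Z w|) by exact: measurableT_comp.
rewrite (_ : [set _ | _] = (fun w => `|Z w|) @^-1` `]x, +oo[); last first.
  by apply/seteqP; split => w /=; rewrite in_itv/= andbT.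
by rewrite -[X in measurable X]setTI; exact: mZ.
Qed.

Lemma abs_tailE x : (abs_tail x)%:E = P [set w | x < `|Z w|].
Proof. by rewrite fineK// fin_num_measure//; exact: measurable_abs_gt. Qed.

Lemma abs_tail_le1 x : abs_tail x <= 1.
Proof. by rewrite -lee_fin abs_tailE probability_le1//; exact: measurable_abs_gt. Qed.

Lemma abs_tail_anti x y : x <= y -> abs_tail y <= abs_tail x.
Proof.
move=> xy; rewrite -lee_fin !abs_tailE le_measure ?inE//; try exact: measurable_abs_gt.
by move=> w /=; exact: le_lt_trans.
Qed.

Lemma abs_tail_split x : 0 <= x ->
  abs_tail x = fine (P [set w | x < Z w]) + fine (P [set w | Z w < - x]).
Proof.
move=> x0.
have m1 : measurable [set w | x < Z w].
  rewrite (_ : [set _ | _] = Z @^-1` `]x, +oo[); first exact: measurable_funPTI.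
  by apply/seteqP; split => w /=; rewrite in_itv/= andbT.
have m2 : measurable [set w | Z w < - x].
  rewrite (_ : [set _ | _] = Z @^-1` `]-oo, (- x)[); first exact: measurable_funPTI.
  by apply/seteqP; split => w /=; rewrite in_itv/=.
apply: EFin_inj; rewrite EFinD abs_tailE !fineK ?fin_num_measure//.
rewrite -measureU//.
  congr (P _); apply/seteqP; split => w /=.
    by rewrite ltr_normr => /orP[|]; [left|right; lra].
  by rewrite ltr_normr => -[->//|?]; apply/orP; right; lra.
by apply/seteqP; split => // w [/= ? ?]; lra.
Qed.

Section RegularVariation.
Variables (alpha qp qm : R) (L : R -> R).
Hypothesis q_sum : qp + qm = 1.
Hypothesis L_sv : slowly_varying L.
Hypothesis right_tail : fine (P [set w | x < Z w]) / (L x * x `^ (- alpha))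
                          @[x --> +oo] --> qp.
Hypothesis left_tail : fine (P [set w | Z w < - x]) / (L x * x `^ (- alpha))
                         @[x --> +oo] --> qm.

(** The two one-sided ratios add up to [1], so the tail of [|Z|] is within a factor
[2] of [L x * x^(-alpha)]; half of [e] absorbs [L] and the other half the factor. *)
Lemma abs_tail_bounds (e : R) : 0 < e ->
  \forall x \near +oo, x `^ (- alpha - e) <= abs_tail x <= x `^ (- alpha + e).
Proof.
move=> e0; have e20 : 0 < e / 2 by lra.
have c1 : fine (P [set w | x < Z w]) / (L x * x `^ (- alpha)) +
   fine (P [set w | Z w < - x]) / (L x * x `^ (- alpha)) @[x --> +oo] --> (1 : R).
  by rewrite -q_sum; exact: cvgD.
have /cvgrPdist_lt/(_ (1/2)) := c1.
have : 0 < 1 / 2 :> R by lra.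
move=> /[swap]/[apply] c2.
have Lb := slowly_varying_bounds L_sv e20.
have big := powR_eventually_ge 2 e20.
near=> x.
have x0 : 0 < x by near: x; exact: nbhs_pinfty_gt (num_real _).
have : `|1 - (fine (P [set w | x < Z w]) / (L x * x `^ (- alpha)) +
   fine (P [set w | Z w < - x]) / (L x * x `^ (- alpha)))| < 1 / 2 by near: x.
have : x `^ (- (e / 2)) <= L x <= x `^ (e / 2) by near: x.
have b2 : 2 <= x `^ (e / 2) by near: x.
rewrite -mulrDl -(abs_tail_split (ltW x0)).
have split_e (s : R) : x `^ (- alpha + s) = x `^ (- alpha) * x `^ s.
  by rewrite powRD// (gt_eqF x0) implybT.
rewrite (_ : - alpha - e = - alpha + (- (e / 2) - e / 2)); last by lra.
rewrite (_ : - alpha + e = - alpha + (e / 2 + e / 2)); last by lra.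
rewrite !split_e !powRD ?(gt_eqF x0) ?implybT// powRN.
have := powR_gt0 (- alpha) x0; have := powR_gt0 (e / 2) x0.
move: b2; set u := x `^ (e / 2); set v := x `^ (- alpha) => u2 u0 v0 /andP[L1 L2].
have V0 : 0 < u^-1 by rewrite invr_gt0.
have Lv0 : 0 < L x * v by rewrite mulr_gt0// (lt_le_trans V0).
rewrite ltr_norml => /andP[g1 g2].
have G1 : abs_tail x <= 2 * (L x * v) by rewrite -ler_pdivrMr//; lra.
have G2 : (1 / 2) * (L x * v) <= abs_tail x by rewrite -ler_pdivlMr//; lra.
have Lv1 : L x * v <= u * v by rewrite ler_pM2r.
have Lv2 : u^-1 * v <= L x * v by rewrite ler_pM2r.
apply/andP; split.
  apply: (le_trans _ G2); apply: (@le_trans _ _ (1 / 2 * (u^-1 * v))); last lra.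
  have -> : v * (u^-1 * u^-1) = u^-1 * (u^-1 * v) by ring.
  apply: ler_wpM2r; first exact: mulr_ge0 (ltW _) (ltW _).
  by rewrite div1r lef_pV2 ?posrE.
apply: (le_trans G1); apply: (@le_trans _ _ (2 * (u * v))); first lra.
have -> : v * (u * u) = u * (u * v) by ring.
by apply: ler_wpM2r => //; exact: mulr_ge0 (ltW _) (ltW _).
Unshelve. all: by end_near. Qed.

(** If [a k < k^r], then [k P(|Z| > a k) >= k^(1 - r (alpha + e))], which is large
when [r alpha < 1] and [e] is small, whereas the left side tends to [1]. *)
Lemma quantile_growth (a : nat -> R) (r : R) :
  k%:R * abs_tail (a k) @[k --> \oo] --> (1 : R) ->
  0 < r -> r * alpha < 1 -> \forall k \near \oo, k%:R `^ r <= a k.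
Proof.
move=> atail r0 ra1.
pose e := (1 - r * alpha) / (2 * r).
have e0 : 0 < e by rewrite divr_gt0 ?mulr_gt0//; lra.
have re : r * (- alpha - e) = - 1 + (1 - r * alpha) / 2.
  rewrite mulrDr mulrN /e; have -> : r * - ((1 - r * alpha) / (2 * r)) = - ((1 - r * alpha) / 2).
    by field; rewrite gt_eqF.
  by lra.
have [X [_ HX]] := abs_tail_bounds e0.
have c2 : \forall k \near \oo, k%:R * abs_tail (a k) < 2 by apply: (cvgr_lt _ atail); lra.
have b2 : \forall x \near +oo, 2 <= x `^ ((1 - r * alpha) / 2).
  by apply: powR_eventually_ge; lra.
have bX := powR_eventually_ge (X + 1) r0.
near=> k; rewrite leNgt; apply/negP => ak.
have k0 : 0 < k%:R :> R by rewrite ltr0n; near: k; exact: nbhs_infty_gt.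
have kX : X < k%:R `^ r.
  rewrite (@lt_le_trans _ _ (X + 1))//; first by lra.
  by near: k; exact: (near_natr bX).
have : k%:R * abs_tail (a k) < 2 by near: k.
apply/negP; rewrite -leNgt.
have /andP[+ _] := HX _ kX => t1.
have t2 := abs_tail_anti (ltW ak).
apply: (@le_trans _ _ (k%:R `^ ((1 - r * alpha) / 2))).
  by near: k; exact: (near_natr b2).
have -> : (1 - r * alpha) / 2 = 1 + r * (- alpha - e) by rewrite re; lra.
rewrite powRD ?(gt_eqF k0) ?implybT// (powRr1 (ltW k0)) powRrM.
by rewrite ler_pM2l//; exact: le_trans t1 t2.
Unshelve. all: by end_near. Qed.

End RegularVariation.
End Tails.

(** * Absolute and truncated moments *)

Section Moments.
Context d (T : measurableType d) (R : realType) (P : probability T R).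
Variable Z : {RV P >-> R}.

Local Notation Er f := (Rintegral P setT f).
Local Notation integrable f := (P.-integrable setT (EFin \o f)).

Lemma measurable_abs_powR (k : R) : measurable_fun setT (fun w => `|Z w| `^ k).
Proof.
apply: (measurableT_comp (measurable_powR k)).
exact: measurableT_comp.
Qed.

(** Dyadic layer cake: [|Z|^k] is at most [1] plus the sum over [n] of
[(2^(n+1))^k] on the event [2^n < |Z|], and the expectations of these terms are
dominated by a geometric series of ratio [2^(k - k')]. *)
Lemma abs_moment_integrable (k k' : R) : 0 < k -> k < k' ->
  (\forall x \near +oo, abs_tail Z x <= x `^ (- k')) ->
  integrable (fun w => `|Z w| `^ k).
Proof.
move=> k0 kk' [X [_ HX]].
have k'0 : 0 < k' by exact: lt_trans kk'.
have [C C0 HC] : exists2 C, 0 <= C & forall x, 0 < x -> abs_tail Z x <= C * x `^ (- k').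
  (* Below [X] the tail is at most [1 <= X^k' x^(-k')], above it the bound holds as is. *)
  exists (Num.max 1 (X `^ k')) => [|x x0]; first by rewrite le_max ler01.
  have [xX|Xx] := leP x X.
    apply: (@le_trans _ _ (X `^ k' * x `^ (- k'))).
      apply: (le_trans (abs_tail_le1 Z x)).
      rewrite powRN ler_pdivlMr ?powR_gt0// mul1r.
      by apply: ge0_ler_powR; rewrite ?nnegrE ?(ltW k'0)// ?(ltW x0)// (le_trans (ltW x0)).
    by rewrite ler_wpM2r ?powR_ge0// le_max lexx orbT.
  apply: (le_trans (HX _ Xx)); rewrite ler_peMl ?powR_ge0//.
  by rewrite le_max lexx.
pose c n : R := (2 ^+ n.+1) `^ k.
pose g n w : \bar R := (c n * \1_[set w | 2 ^+ n < `|Z w|] w)%:E.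
have g0 n w : (0 <= g n w)%E by rewrite lee_fin mulr_ge0 ?powR_ge0.
have mg n : measurable_fun setT (g n).
  apply/measurable_EFinP; apply: measurable_funM => //.
  by apply: measurable_indic; exact: measurable_abs_gt.
apply/integrableP; split.
  by apply/measurable_EFinP; exact: measurable_abs_powR.
have le1 w : (`|(`|Z w| `^ k)%:E| <= 1 + \sum_(0 <= n <oo) g n w)%E.
  rewrite gee0_abs ?lee_fin ?powR_ge0//.
  have [Z1|Z1] := leP (`|Z w|) 1.
    apply: (@le_trans _ _ 1%E).
      have p1 : 1 = 1 `^ k :> R by rewrite powR1.
      rewrite lee_fin [leRHS]p1.
      by apply: ge0_ler_powR; rewrite ?nnegrE ?(ltW k0).
    by rewrite leeDl// nneseries_ge0.
  have [n] : exists n, 2 ^+ n < `|Z w| <= 2 ^+ n.+1.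
    have : exists n, `|Z w| <= 2 ^+ n.
      exists (Num.truncn `|Z w|).+1.
      apply: (le_trans (ltW (truncnS_gt _))).
      by rewrite -natrX ler_nat ltnW// ltn_expl.
    move=> ex; case: (ex_minnP ex) => -[|n] Hn min; first by rewrite expr0 leNgt Z1 in Hn.
    by exists n; rewrite Hn andbT ltNge; apply/negP => /min; rewrite ltnn.
  move=> /andP[n1 n2].
  apply: (@le_trans _ _ (\sum_(0 <= i < n.+1) g i w)%E).
    rewrite big_nat_recr//=; apply: (@le_trans _ _ (g n w)).
      rewrite lee_fin indicE mem_set// mulr1.
      by apply: ge0_ler_powR; rewrite ?nnegrE ?(ltW k0)// exprn_ge0.
    by rewrite leeDr// sume_ge0.
  apply: (@le_trans _ _ (\sum_(0 <= i <oo) g i w)%E); first exact: nneseries_lim_ge.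
  by rewrite leeDr.
have mS : measurable_fun setT (fun w => \sum_(0 <= n <oo) g n w)%E.
  by apply: ge0_emeasurable_sum.
have S0 w : (0 <= \sum_(0 <= n <oo) g n w)%E by exact: nneseries_ge0.
apply: (@le_lt_trans _ _ (\int[P]_w (1 + \sum_(0 <= n <oo) g n w))%E).
  apply: ge0_le_integral => //.
  - by apply: measurableT_comp => //; apply/measurable_EFinP; exact: measurable_abs_powR.
  - exact: emeasurable_funD.
  - by move=> w _; exact: le1.
rewrite (@ge0_integralD _ _ _ P setT measurableT (cst 1%E))//.
have -> : (\int[P]_x cst 1 x = 1)%E by rewrite integral_cst// mul1e; exact: probability_setT.
apply: lte_add_pinfty; first exact: ltry.
rewrite integral_nneseries//.
pose q : R := 2 `^ (k - k').
have q1 : q < 1.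
  have -> : 1 = 2 `^ 0 :> R by rewrite powRr0.
  by rewrite /q /powR pnatr_eq0 /= ltr_expR ltr_pM2r ?subr_lt0// ln_gt0// ltr1n.
have q0 : 0 < q by rewrite powR_gt0.
pose C' := C * 2 `^ k.
have C'0 : 0 <= C' by rewrite mulr_ge0 ?powR_ge0.
apply: (@le_lt_trans _ _ (\sum_(0 <= n <oo) (C' * q ^+ n)%:E)%E).
  apply: lee_nneseries => [n _ _|n _]; first exact: integral_ge0.
  rewrite (_ : (\int[P]_x g n x = (c n * abs_tail Z (2 ^+ n))%:E)%E); last first.
    under eq_integral do rewrite /g EFinM.
    rewrite ge0_integralZl//; last 2 first.
    - by apply/measurable_EFinP/measurable_indic; exact: measurable_abs_gt.
    - by rewrite lee_fin powR_ge0.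
    by rewrite integral_indic//; [rewrite setIT EFinM abs_tailE|exact: measurable_abs_gt].
  rewrite lee_fin; apply: (@le_trans _ _ (c n * (C * (2 ^+ n) `^ (- k')))).
    by apply: ler_wpM2l; [exact: powR_ge0|apply: HC; exact: exprn_gt0].
  have pX (t : R) : (2 ^+ n) `^ t = (2 `^ t) ^+ n :> R.
    by rewrite -!powR_mulrn ?powR_ge0// -!powRrM mulrC.
  rewrite /c /C' /q exprS powRM ?exprn_ge0// !pX powRD ?pnatr_eq0 ?implybT// exprMn.
  by rewrite le_eqVlt; apply/orP; left; apply/eqP; ring.
apply: (@le_lt_trans _ _ (C' / (1 - q))%:E); last exact: ltry.
apply: lime_le.
  by apply: is_cvg_nneseries => n _ _; rewrite lee_fin mulr_ge0// exprn_ge0// ltW.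
apply: nearW => n; rewrite sumEFin lee_fin.
have := geometric_seriesE C' (_ : q != 1) => /(_ (negbT (lt_eqF q1))).
move=> /(congr1 (fun f => f n)); rewrite /series /geometric /= => ->.
rewrite ler_pM2r ?invr_gt0 ?subr_gt0// ler_piMr// lerBlDr lerDl.
by rewrite exprn_ge0// ltW.
Qed.

Definition truncate (b z : R) : R := if `|z| <= b then z else 0.

Lemma measurable_truncate b : measurable_fun setT (truncate b).
Proof.
apply: measurable_fun_if => //.
by apply: measurable_fun_ler => //; exact: measurableT_comp.
Qed.

Lemma normr_truncate_le b z : 0 <= b -> `|truncate b z| <= b.
Proof. by move=> b0; rewrite /truncate; case: ifP => // _; rewrite normr0. Qed.

Lemma measurable_truncX b m : measurable_fun setT (fun w => truncate b (Z w) ^+ m).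
Proof.
by apply: measurable_funX; apply: measurableT_comp => //; exact: measurable_truncate.
Qed.

Lemma bounded_integrable (f : T -> R) (M : R) : measurable_fun setT f ->
  (forall w, `|f w| <= M) -> integrable f.
Proof.
move=> mf fM; apply: measurable_bounded_integrable => //.
  exact: (le_lt_trans (probability_le1 P measurableT) (ltry 1)).
exists M; split; first exact: num_real.
by move=> x Mx w _; exact: le_trans (fM w) (ltW Mx).
Qed.

Lemma expectation_const (c : R) : Er (fun=> c) = c.
Proof.
rewrite Rintegral_cst//; transitivity (c * fine (1%E : \bar R)).
  by congr (_ * fine _); exact: probability_setT.
exact: mulr1.
Qed.

Lemma truncX_integrable b m : 0 <= b -> integrable (fun w => truncate b (Z w) ^+ m).
Proof.
move=> b0; apply: (@bounded_integrable _ (b ^+ m)); first exact: measurable_truncX.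
by move=> w; rewrite normrX lerXn2r ?nnegrE// normr_truncate_le.
Qed.

(** For [m >= k] the bound holds because [|U|^m <= b^(m-k) |Z|^k].  For [m = 1 < k]
the variable [Z] is integrable, hence centered, so that [E U = - E (Z - U)], and
[Z - U] lives where [|Z| > b].  For the moments in between, [|U|^m <= 1 + |Z|^k]. *)
Lemma truncated_moments (k : R) : 0 < k ->
  integrable (fun w => `|Z w| `^ k) ->
  (('E_P[(fun w => `|Z w|%R)] < +oo)%E -> ('E_P[Z] = 0)%E) ->
  exists2 C : R, 1 <= C &
  forall (b : R) (m : nat), 1 <= b -> (0 < m)%N ->
    `|Er (fun w => truncate b (Z w) ^+ m)| <=
      C * (if (m == 1%N) || (k <= m%:R) then b `^ (m%:R - k) else 1).
Proof.
move=> k0 ik centered.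
have M0 : 0 <= Er (fun w => `|Z w| `^ k) by apply: Rintegral_ge0 => w _; exact: powR_ge0.
exists (1 + Er (fun w => `|Z w| `^ k)); first by rewrite lerDl.
move=> b m b1 m0.
have b0 : 0 < b by exact: lt_le_trans b1.
have iU n := truncX_integrable n (ltW b0).
have iU' n : integrable (fun w => `|truncate b (Z w) ^+ n|).
  exact: (integrable_norm (iU n)).
have i1 : integrable (fun _ : T => 1 : R) by exact: finite_measure_integrable_cst.
have high n : k <= n%:R -> `|Er (fun w => truncate b (Z w) ^+ n)| <=
    b `^ (n%:R - k) * Er (fun w => `|Z w| `^ k).
  move=> kn; apply: (le_trans (le_normr_Rintegral _ (iU n))) => //.
  rewrite -RintegralZl//; apply: le_Rintegral => //.
    exact: (integrableZl measurableT (b `^ (n%:R - k)) ik).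
  move=> w _; rewrite normrX /truncate; case: ifP => [zb|_]; last first.
    rewrite normr0 expr0n; case: eqP => [n0|_].
      by move: kn; rewrite n0 leNgt k0.
    by rewrite mulr_ge0 ?powR_ge0.
  have [z0|z0] := eqVneq (`|Z w|) 0.
    rewrite z0 expr0n; case: eqP => [n0|_].
      by move: kn; rewrite n0 leNgt k0.
    by rewrite mulr_ge0 ?powR_ge0.
  rewrite -powR_mulrn// -{1}(subrK k n%:R) powRD ?z0 ?implybT//.
  apply: ler_wpM2r; first exact: powR_ge0.
  by apply: ge0_ler_powR; rewrite ?nnegrE ?subr_ge0// ltW.
case: ifPn => [|/norP[m1 km]]; last first.
  rewrite mulr1; apply: (le_trans (le_normr_Rintegral _ (iU m))) => //.
  have -> : 1 + Er (fun w => `|Z w| `^ k) = Er (fun w => 1 + `|Z w| `^ k).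
    by rewrite RintegralD// expectation_const.
  apply: le_Rintegral => //; first exact: integrableD i1 ik.
  move=> w _; rewrite normrX /truncate; case: ifP => [zb|_]; last first.
    by rewrite normr0 expr0n (gtn_eqF m0) addr_ge0 ?powR_ge0.
  have [z1|z1] := leP (`|Z w|) 1.
    by rewrite -[leLHS]addr0 lerD ?powR_ge0// exprn_ile1.
  rewrite -powR_mulrn// -[leLHS]add0r lerD//.
  by apply: ler_powR; rewrite ltW// ltNge.
have [km _|mk] := leP k m%:R.
  apply: (le_trans (high _ km)); rewrite mulrC; apply: ler_wpM2r; first exact: powR_ge0.
  by rewrite lerDr.
rewrite orbF => /eqP m1; move: mk; rewrite m1 => k1 {m m0 m1}.
have iZ : integrable Z.
  apply: (@le_integrable _ _ _ P setT measurableT _ (EFin \o (fun w => 1 + `|Z w| `^ k))).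
  - by apply/measurable_EFinP.
  - move=> w _; rewrite /= lee_fin [leRHS]ger0_norm ?addr_ge0 ?powR_ge0//.
    have [z1|z1] := leP (`|Z w|) 1; first by rewrite -[leLHS]addr0 lerD ?powR_ge0.
    rewrite -[leLHS]add0r lerD// le1r_powR// ltW//.
  - exact: (integrableD measurableT i1 ik).
have EZ0 : Er Z = 0.
  have : ('E_P[Z] = 0)%E.
    apply: centered; rewrite unlock.
    have /integrableP[_] := integrable_norm iZ.
    by under eq_integral do rewrite /= normr_id.
  by rewrite unlock /Rintegral => ->.
have iU1 : integrable (fun w => truncate b (Z w)) by exact: (iU 1%N).
have -> : Er (fun w => truncate b (Z w) ^+ 1) = - Er (fun w => Z w - truncate b (Z w)).
  by rewrite RintegralB// EZ0 sub0r opprK.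
have iD : integrable (fun w => Z w - truncate b (Z w)) by exact: integrableB iZ iU1.
rewrite normrN; apply: (le_trans (le_normr_Rintegral _ iD)) => //.
apply: (@le_trans _ _ (b `^ (1 - k) * Er (fun w => `|Z w| `^ k))); last first.
  by rewrite mulrC; apply: ler_wpM2r; rewrite ?powR_ge0// lerDr.
rewrite -RintegralZl//; apply: le_Rintegral => //.
- exact: (integrable_norm iD).
- exact: (integrableZl measurableT (b `^ (1 - k)) ik).
move=> w _; rewrite /truncate; case: ifPn => [_|].
  by rewrite subrr normr0 mulr_ge0 ?powR_ge0.
rewrite -ltNge subr0 => bz; have z0 : 0 < `|Z w| by exact: lt_trans bz.
rewrite -[leLHS]powRr1// -{1}(subrK k 1) powRD ?(gt_eqF z0) ?implybT//.
apply: ler_wpM2r; first exact: powR_ge0.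
rewrite -opprB !powRN lef_pV2 ?posrE ?powR_gt0//.
by apply: ge0_ler_powR; rewrite ?nnegrE ?subr_ge0// ltW.
Qed.

End Moments.

(** * Independence and expectations of products *)

Section Independence.
Context d (T : measurableType d) (R : realType) (P : probability T R).

Local Notation Er f := (Rintegral P setT f).
Local Notation integrable f := (P.-integrable setT (EFin \o f)).

Definition independent_rv (X Y : T -> R) : Prop := forall A B : set R,
  measurable A -> measurable B ->
  P (X @^-1` A `&` Y @^-1` B) = (P (X @^-1` A) * P (Y @^-1` B))%E.

(** Independence says that the law of [(X, Y)] is the product of the laws of [X] and
[Y]; the claim is Fubini's theorem for the function [(x, y) |-> x y]. *)
Lemma independent_expectation_mfun (X Y : {mfun T >-> R}) :
  independent_rv X Y -> integrable X -> integrable Y ->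
  integrable (fun w => X w * Y w) /\ Er (fun w => X w * Y w) = Er X * Er Y.
Proof.
move=> XY iX iY.
have mXY : measurable_fun setT (fun w => (X w, Y w)) by exact: measurable_fun_pair.
pose W : {mfun T >-> (R * R)%type} := mfun_Sub (mem_set mXY).
pose mX := distribution P X; pose mY := distribution P Y.
have prodE (A : set (R * R)) : measurable A -> (mX \x mY)%E A = distribution P W A.
  by move=> mA; apply: product_measure_unique.
pose f (z : R * R) : \bar R := (z.1 * z.2)%:E.
have mf : measurable_fun setT f.
  by apply/measurable_EFinP; apply: measurable_funM.
have iidX : mX.-integrable setT (EFin : R -> \bar R).
  exact: (integrable_pushforward (measurable_funPT X) (@EFin_measurable R setT) iX measurableT).
have iidY : mY.-integrable setT (EFin : R -> \bar R).
  exact: (integrable_pushforward (measurable_funPT Y) (@EFin_measurable R setT) iY measurableT).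
have EX : (\int[mX]_x x%:E = \int[P]_w (X w)%:E)%E by exact: integral_distribution.
have EY : (\int[mY]_x x%:E = \int[P]_w (Y w)%:E)%E by exact: integral_distribution.
have ifprod : (mX \x mY)%E.-integrable setT f.
  apply/integrable12ltyP => //.
  have /integrableP[_ aY] := iidY; have /integrableP[_ aX] := iidX.
  have fY : (\int[mY]_y `|y%:E| \is a fin_num)%E.
    by rewrite ge0_fin_numE// integral_ge0.
  have absf x : (\int[mY]_y `|f (x, y)| = (fine (\int[mY]_y `|y%:E|))%:E * `|x%:E|)%E.
    rewrite (fineK fY) muleC -ge0_integralZl//; last exact/measurableT_comp.
    by apply: eq_integral => y _; rewrite -abseM.
  under eq_integral do rewrite absf.
  rewrite ge0_integralZl//; last 2 first.
  - exact/measurableT_comp.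
  - by rewrite lee_fin fine_ge0// integral_ge0.
  by apply: lte_mul_pinfty => //; rewrite ?lee_fin ?fine_ge0 ?integral_ge0.
have ifW : integrable (fun w => X w * Y w).
  apply/integrableP; split.
    by apply/measurable_EFinP; apply: measurable_funM.
  have /integrableP[_] := ifprod.
  rewrite (eq_measure_integral (distribution P W)); last by move=> A mA _; exact: prodE.
  by rewrite ge0_integral_distribution//; exact/measurableT_comp.
split=> //; apply: EFin_inj.
rewrite EFinM /Rintegral !fineK; try exact: integrable_fin_num.
transitivity (\int[distribution P W]_z f z)%E; first by rewrite integral_distribution.
rewrite -(eq_measure_integral (distribution P W) (m1 := (mX \x mY)%E)); last first.
  by move=> A mA _; exact: prodE.
rewrite -integral12_prod_meas1// /fubini_F.
have fY : (\int[mY]_y y%:E \is a fin_num)%E by exact: integrable_fin_num.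
have meanf x : (\int[mY]_y f (x, y) = (fine (\int[mY]_y y%:E))%:E * x%:E)%E.
  by rewrite (fineK fY) muleC -integralZl.
transitivity (\int[mX]_x ((fine (\int[mY]_y y%:E))%:E * x%:E))%E.
  by apply: eq_integral => x _; exact: meanf.
by rewrite integralZl// fineK// EX EY muleC.
Qed.

Lemma independent_expectation (X Y : T -> R) :
  measurable_fun setT X -> measurable_fun setT Y ->
  independent_rv X Y -> integrable X -> integrable Y ->
  integrable (fun w => X w * Y w) /\ Er (fun w => X w * Y w) = Er X * Er Y.
Proof.
move=> mX mY.
exact: (@independent_expectation_mfun (mfun_Sub (mem_set mX)) (mfun_Sub (mem_set mY))).
Qed.

(** The finite measures [A |-> P (A `&` B)] and [A |-> P A * P B] agree on the
pi-system [G], hence on the sigma-algebra that it generates. *)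
Lemma independent_generated (G : set (set T)) (B : set T) :
  G `<=` measurable -> setI_closed G -> G setT -> measurable B ->
  (forall A, G A -> P (A `&` B) = (P A * P B)%E) ->
  forall A, <<s G >> A -> P (A `&` B) = (P A * P B)%E.
Proof.
move=> Gm GI GT mB H A sA.
have fB : P B \is a fin_num by exact: fin_num_measure.
have fB0 : 0 <= fine (P B) by exact: fine_ge0.
(* The second measure is [P] scaled by the number [P B]. *)
pose k := NngNum fB0.
have := @g_sigma_algebra_measure_unique _ R T G Gm (fun=> setT) (fun=> GT) _
  (mrestr P mB) (mscale k P) GI.
rewrite bigcup_const// => /(_ erefl) U.
have : mrestr P mB A = mscale k P A.
  apply: U => //.
  - by move=> C GC; rewrite /mrestr/= /mscale/= fineK// muleC; exact: H.
  - move=> _; rewrite /mrestr/=; apply: (le_lt_trans _ (ltry 1)).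
    by apply: probability_le1; exact: measurableI.
by rewrite /mrestr/= /mscale/= fineK// muleC.
Qed.

End Independence.

Section Fields.
Context d (T : measurableType d) (R : realType) (P : probability T R).
Implicit Types Y Z : nat -> nat -> {RV P >-> R}.

Local Notation Er f := (Rintegral P setT f).
Local Notation integrable f := (P.-integrable setT (EFin \o f)).

(** Measurability with respect to the sigma-algebra generated by [G], stated through
preimages so that [f] keeps its type. *)
Definition measurable_for (G : set (set T)) (f : T -> R) : Prop :=
  forall B : set R, measurable B -> <<s G >> (f @^-1` B).

Lemma measurable_forP G f :
  measurable_for G f <-> measurable_fun [set: g_sigma_algebraType G] (f : g_sigma_algebraType G -> R).
Proof.
split=> [H _ B mB|H B mB]; first by rewrite setTI; exact: H.
by have := H measurableT B mB; rewrite setTI.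
Qed.

Lemma measurable_for_prod G (I : eqType) (s : seq I) (h : I -> T -> R) :
  (forall i, i \in s -> measurable_for G (h i)) ->
  measurable_for G (fun w => \prod_(i <- s) h i w).
Proof.
move=> H; apply/measurable_forP.
by apply: measurable_prod => i si; apply/measurable_forP; exact: H.
Qed.

Lemma measurable_for_comp G f (g : R -> R) : measurable_fun setT g ->
  measurable_for G f -> measurable_for G (g \o f).
Proof.
move=> mg /measurable_forP mf; apply/measurable_forP.
exact: (measurableT_comp mg mf).
Qed.

Lemma measurable_for_field Y i t :
  measurable_for [set A | exists i t (B : set R), measurable B /\ A = Y i t @^-1` B]
    (Y i t).
Proof. by move=> B mB; apply: sub_sigma_algebra; exists i, t, B. Qed.

(** Products of functions of finitely many variables of a field are measurable for
its sigma-algebra, so the independence of the fields applies to them. *)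
Lemma independent_fields_expectation Y Z (I : eqType) (s s' : seq I)
    (f g : I -> R -> R) (u v : I -> nat * nat) :
  independent_fields Y Z ->
  (forall i, measurable_fun setT (f i)) -> (forall i, measurable_fun setT (g i)) ->
  let F w := \prod_(i <- s) f i (Y (u i).1 (u i).2 w) in
  let G w := \prod_(i <- s') g i (Z (v i).1 (v i).2 w) in
  integrable F -> integrable G ->
  integrable (fun w => F w * G w) /\ Er (fun w => F w * G w) = Er F * Er G.
Proof.
move=> YZ mf mg F G.
apply: independent_expectation.
- by apply: measurable_prod => i _; exact: measurableT_comp.
- by apply: measurable_prod => i _; exact: measurableT_comp.
move=> A B mA mB; apply: YZ.
- apply: measurable_for_prod mA => i _; apply: (measurable_for_comp (mf i)).
  exact: measurable_for_field.
- apply: measurable_for_prod mB => i _; apply: (measurable_for_comp (mg i)).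
  exact: measurable_for_field.
Qed.

(** A pi-system that generates the sigma-algebra of the variables indexed by [J]. *)
Definition cylinders Z (J : {fset nat * nat}) : set (set T) :=
  [set A | exists2 B : nat * nat -> set R, (forall j, measurable (B j)) &
     A = \bigcap_(j in [set` J]) (Z j.1 j.2 @^-1` B j)].

Lemma measurable_for_cylinders Z J e : e \in J ->
  measurable_for (cylinders Z J) (Z e.1 e.2).
Proof.
move=> eJ B mB; apply: sub_sigma_algebra.
exists (fun j => if j == e then B else setT); first by move=> j; case: ifP.
apply/seteqP; split => w /=.
  by move=> Bw j /= _; case: eqP => // ->.
by move=> /(_ e eJ); rewrite /= eqxx.
Qed.

Lemma cylinders_independent Z (J : {fset nat * nat}) e (B : set R) A :
  mutually_independent Z -> e \notin J -> measurable B -> <<s cylinders Z J >> A ->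
  P (A `&` Z e.1 e.2 @^-1` B) = (P A * P (Z e.1 e.2 @^-1` B))%E.
Proof.
move=> indZ eJ mB.
have mZ j C : measurable C -> measurable (Z j.1 j.2 @^-1` C).
  by move=> mC; exact: measurable_funPTI.
apply: independent_generated => //.
- move=> _ [C mC ->]; apply: fin_bigcap_measurable; first exact: finite_fset.
  by move=> j _; exact: mZ.
- move=> _ _ [C mC ->] [D mD ->]; exists (fun j => C j `&` D j).
    by move=> j; exact: measurableI.
  by rewrite -bigcapI.
- exists (fun=> setT) => //; apply/esym; rewrite -subTset => w _ j _ //.
- exact: mZ.
move=> _ [C mC ->].
(* Join [e] to the index set, with [B] as its event, in the product rule. *)
pose C' j := if j == e then B else C j.
have mC' j : measurable (C' j) by rewrite /C'; case: ifP.
have := indZ (e |` J)%fset C' (fun j _ => mC' j).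
rewrite set_fsetU1 bigcap_setU1 big_fsetU1//= {1 3}/C' eqxx.
have := indZ J C (fun j _ => mC j).
have -> : \bigcap_(j in [set` J]) (Z j.1 j.2 @^-1` C' j) =
          \bigcap_(j in [set` J]) (Z j.1 j.2 @^-1` C j).
  apply: eq_bigcapr => j /= jJ; rewrite /C'; case: eqP => // je.
  by move: eJ; rewrite -je jJ.
have -> : (\prod_(j <- J) P (Z j.1 j.2 @^-1` C' j) =
           \prod_(j <- J) P (Z j.1 j.2 @^-1` C j))%E.
  apply: eq_big_seq => j jJ; rewrite /C'; case: eqP => // je.
  by move: eJ; rewrite -je jJ.
by move=> -> E; rewrite setIC E muleC.
Qed.

(** The variables are split off one at a time, each being independent of the
sigma-algebra of those that remain. *)
Lemma independent_prod_expectation Z (f : nat * nat -> R -> R) (M : R)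
    (J : seq (nat * nat)) :
  mutually_independent Z -> (forall e, measurable_fun setT (f e)) ->
  (forall e z, `|f e z| <= M) -> uniq J ->
  integrable (fun w => \prod_(e <- J) f e (Z e.1 e.2 w)) /\
  Er (fun w => \prod_(e <- J) f e (Z e.1 e.2 w)) =
  \prod_(e <- J) Er (fun w => f e (Z e.1 e.2 w)).
Proof.
move=> indZ mf fM.
have mfZ e : measurable_fun setT (fun w => f e (Z e.1 e.2 w)).
  exact: (measurableT_comp (mf e)).
have ifZ e : integrable (fun w => f e (Z e.1 e.2 w)).
  by apply: (@bounded_integrable _ _ _ P _ M).
elim: J => [_|e J IH /= /andP[eJ uJ]].
  have e1 : (fun w : T => \prod_(e <- [::]) f e (Z e.1 e.2 w)) = fun=> 1.
    by apply/funext => w; rewrite big_nil.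
  rewrite e1 big_nil; split; last exact: expectation_const.
  exact: finite_measure_integrable_cst.
have [iJ EJ] := IH uJ.
have e1 : (fun w : T => \prod_(i <- e :: J) f i (Z i.1 i.2 w)) =
    fun w => (\prod_(i <- J) f i (Z i.1 i.2 w)) * f e (Z e.1 e.2 w).
  by apply/funext => w; rewrite big_cons mulrC.
rewrite e1 big_cons [RHS]mulrC -EJ.
apply: independent_expectation => //.
  by apply: measurable_prod.
move=> A B mA mB.
rewrite -[_ @^-1` B]/(Z e.1 e.2 @^-1` (f e @^-1` B)).
apply: (@cylinders_independent _ [fset x in J]%fset) => //.
- by rewrite inE.
- by rewrite -[_ @^-1` _]setTI; exact: mf.
apply: measurable_for_prod mA => i iJ'.
apply: (measurable_for_comp (mf i)); apply: measurable_for_cylinders.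
by rewrite inE.
Qed.

End Fields.

(** * Walks on the complete bipartite graph of rows and columns *)

Section Walks.
Variables (I J : finType).

Definition walk_start (w : seq (I * J)) (j : I) : I := if w is e :: _ then e.1 else j.

(** A walk is a list of steps (row, column) together with its final row [j]: a step
[(i, t)] leads from the row [i] through the column [t] to the row of the next step.
It uses two edges at [t], so a walk with [k] steps has [2 k] edges. *)
Fixpoint walk_edges (w : seq (I * J)) (j : I) : seq (I * J) :=
  if w is e :: w' then e :: (walk_start w' j, e.2) :: walk_edges w' j else [::].

(** The walks that survive once the diagonal of the matrix is removed. *)
Fixpoint walk_proper (w : seq (I * J)) (j : I) : bool :=
  if w is e :: w' then (e.1 != walk_start w' j) && walk_proper w' j else true.

Fixpoint walks (k : nat) : seq (seq (I * J)) :=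
  if k is k'.+1 then [seq e :: w | e <- enum {: I * J}, w <- walks k'] else [:: [::]].

Lemma sum_walksS (V : nmodType) k (F : seq (I * J) -> V) :
  \sum_(w <- walks k.+1) F w = \sum_(w <- walks k) \sum_(e : I * J) F (e :: w).
Proof. by rewrite /= big_allpairs_dep/= exchange_big/=; apply: eq_bigr => w _; rewrite big_enum. Qed.

Lemma walks_size k w : w \in walks k -> size w = k.
Proof.
elim: k w => [|k IH] w /=; first by rewrite inE => /eqP->.
by case/allpairsP => -[e w'] /= [_ /IH <- ->].
Qed.

Lemma size_walk_edges w j : size (walk_edges w j) = (size w).*2.
Proof. by elim: w => //= e w ->. Qed.

Lemma walk_edges_distinct w j : walk_proper w j -> (0 < size w)%N ->
  (1 < size (undup (walk_edges w j)))%N.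
Proof.
case: w => // -[i t] w /andP[/= il _] _.
have sub : {subset [:: (i, t); (walk_start w j, t)] <=
                   undup (walk_edges ((i, t) :: w) j)}.
  by move=> e; rewrite mem_undup !inE => /orP[]/eqP->; rewrite eqxx ?orbT.
by apply: (uniq_leq_size _ sub); rewrite /= inE andbT xpair_eqE eqxx andbT.
Qed.

(** Prepend a step [(i, t)] to a walk starting at [l], with [i != l].  If the column
[t] is new, both edges [(i, t)] and [(l, t)] are new: weight [q^2], at most [n p]
choices.  If [t] is old but the edge [(i, t)] is new: weight [q], at most [2 k p]
choices.  Otherwise [(i, t)] is one of the [2 k] old edges.  Each step thus
multiplies the total weight by at most [1 + 2 k + 2 k]. *)
Lemma sum_walks_distinct_edges (R : realDomainType) (q : R) k :
  0 <= q -> q <= 1 -> #|J|%:R * #|I|%:R * q ^+ 2 <= 1 -> #|I|%:R * q <= 1 ->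
  \sum_(j : I) \sum_(w <- walks k | walk_proper w j)
     q ^+ size (undup (walk_edges w j)) <=
  (\prod_(i < k) (4 * i + 1)%N)%:R * #|I|%:R.
Proof.
move=> q0 q1 npq pq; elim: k => [|k IH].
  rewrite big_ord0 mul1r; under eq_bigr do rewrite big_mkcond big_seq1/= expr0.
  by rewrite sumr_const.
rewrite big_ord_recr/= natrM mulrAC mulrC.
apply: (le_trans _ (ler_wpM2l _ IH)) => //.
rewrite mulr_sumr; apply: ler_sum => j _.
rewrite big_mkcond sum_walksS mulr_sumr [leRHS]big_mkcond/=.
rewrite [leLHS]big_seq [leRHS]big_seq; apply: ler_sum => w wk.
case: ifP => pw; last by rewrite big1// => e _; rewrite andbF.
set es := walk_edges w j; set l := walk_start w j.
have ses : size es = (2 * k)%N by rewrite size_walk_edges (walks_size wk) mul2n.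
have step (e : I * J) : (if (e.1 != l) && true then
     q ^+ size (undup (e :: (l, e.2) :: es)) else 0) <=
   (q ^+ 2 + (e \in es)%:R + (e.2 \in map snd es)%:R * q) * q ^+ size (undup es).
  have qe0 : 0 <= q ^+ size (undup es) by exact: exprn_ge0.
  case: ifP => [/andP[el _]|_]; last first.
    by rewrite mulr_ge0// !addr_ge0 ?mulr_ge0 ?exprn_ge0 ?ler0n.
  have e_l : (e == (l, e.2)) = false.
    by apply/eqP => ee; move: el; rewrite ee eqxx.
  have [ees|ees] := boolP (e \in es).
    apply: (@le_trans _ _ (1 * q ^+ size (undup es))).
      rewrite mul1r; apply: ler_wiXn2l => //.
      rewrite -[X in (X <= _)%N]/(size _); apply: uniq_leq_size; first exact: undup_uniq.
      by move=> x; rewrite !mem_undup !inE => ->; rewrite !orbT.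
    apply: ler_wpM2r => //; rewrite addrAC lerDr addr_ge0 ?exprn_ge0//.
    by rewrite mulr_ge0 ?ler0n.
  rewrite /= inE e_l (negbTE ees)/=.
  have [tes|tes] := boolP (e.2 \in map snd es); last first.
    have -> : ((l, e.2) \in es) = false.
      by apply/negP => les; move/negP: tes; apply; apply/mapP; exists (l, e.2).
    by rewrite /= mulr0n mul0r !addr0 -exprD.
  rewrite mulr0n addr0 mul1r mulrDl; apply: ler_wpDl.
    by rewrite mulr_ge0// exprn_ge0.
  rewrite exprS; apply: ler_wpM2l => //; apply: ler_wiXn2l => //.
  by case: ifP => //= _.
apply: (@le_trans _ _ (\sum_(e : I * J) (q ^+ 2 + (e \in es)%:R +
   (e.2 \in map snd es)%:R * q) * q ^+ size (undup es))).
  by apply: ler_sum => e _; exact: step.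
rewrite -mulr_suml; apply: ler_wpM2r; first exact: exprn_ge0.
have cardle (S : finType) (s : seq S) : \sum_(x : S) (x \in s)%:R <= (size s)%:R :> R.
  have -> : \sum_(x : S) (x \in s)%:R = #|s|%:R :> R.
    by rewrite -sum1_card natr_sum [RHS]big_mkcond; apply: eq_bigr => x _; case: (x \in s).
  by rewrite ler_nat card_size.
rewrite !big_split/=.
have -> : \sum_(e : I * J) q ^+ 2 = q ^+ 2 * (#|I| * #|J|)%:R by rewrite sumr_const card_prod mulr_natr.
have b1 : q ^+ 2 * (#|I| * #|J|)%:R <= 1 by rewrite natrM mulrC [_ * #|J|%:R]mulrC.
have b2 : \sum_(e : I * J) (e \in es)%:R <= (2 * k)%:R :> R by rewrite -ses.
have b3 : \sum_(e : I * J) (e.2 \in map snd es)%:R * q <= (2 * k)%:R.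
  rewrite -mulr_suml.
  have -> : \sum_(e : I * J) (e.2 \in map snd es)%:R =
      #|I|%:R * \sum_(t : J) (t \in map snd es)%:R :> R.
    rewrite -(pair_big xpredT xpredT (fun _ t => (t \in map snd es)%:R : R))/=.
    by rewrite sumr_const mulr_natl; congr (_ *+ _).
  rewrite mulrAC -[leRHS]mul1r; apply: ler_pM => //.
  - by rewrite mulr_ge0.
  - by apply: sumr_ge0 => t _; rewrite ler0n.
  - by rewrite -ses -(size_map snd) cardle.
have -> : (4 * k + 1)%:R = 1 + (2 * k)%:R + (2 * k)%:R :> R by rewrite !(natrD, natrM); ring.
by apply: lerD => //; exact: lerD.
Qed.

End Walks.

(** * Traces of powers and weights of edges *)

Section TraceExpansion.
Variable R : comPzRingType.

Lemma off_diag_entry (p n : nat) (X : 'M[R]_(p, n)) i j :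
  (X *m X^T - diag_mx (\row_l (X *m X^T) l l)) i j =
  if i == j then 0 else \sum_t X i t * X j t.
Proof.
rewrite !mxE; case: eqVneq => [->|_]; first by rewrite mulr1n subrr.
by rewrite mulr0n subr0; apply: eq_bigr => t _; rewrite !mxE.
Qed.

Lemma off_diag_pow_entry (p n : nat) (X : 'M[R]_(p, n)) (A : 'M[R]_p) k i j :
  (forall i j, A i j = if i == j then 0 else \sum_t X i t * X j t) ->
  (A ^+ k) i j = \sum_(w <- walks 'I_p 'I_n k | walk_proper w j && (walk_start w j == i))
                   \prod_(e <- walk_edges w j) X e.1 e.2.
Proof.
move=> AE; elim: k i => [|k IH] i.
  rewrite expr0 /= big_mkcond big_seq1/= big_nil !mxE.
  have -> : (j == i) = (i == j) by apply/eqP/eqP => ->.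
  by case: eqP.
rewrite exprS !mxE.
transitivity (\sum_(l < p) \sum_(w <- walks 'I_p 'I_n k)
   if walk_proper w j && (walk_start w j == l) then
     A i l * \prod_(e <- walk_edges w j) X e.1 e.2 else 0).
  by apply: eq_bigr => l _; rewrite IH big_distrr/= big_mkcond.
rewrite exchange_big/= [RHS]big_mkcond sum_walksS; apply: eq_bigr => w _.
rewrite [LHS](bigD1 (walk_start w j))//= [X in _ + X = _]big1 ?addr0 => [|l lw]; last first.
  by case: (walk_start w j =P l) lw => [->|_ _]; rewrite ?eqxx ?andbF.
rewrite eqxx andbT AE.
transitivity (\sum_(l < p) \sum_(t < n)
   if (l != walk_start w j) && walk_proper w j && (l == i) then
     \prod_(e <- (l, t) :: (walk_start w j, t) :: walk_edges w j) X e.1 e.2 else 0); last first.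
  by rewrite pair_bigA/=; apply: eq_bigr => -[l t] _.
rewrite [RHS](bigD1 i)//= [X in _ = _ + X]big1 ?addr0; last first.
  by move=> l li; rewrite big1// => t _; rewrite (negbTE li) andbF.
case: (walk_proper w j); last by rewrite andbF big1.
rewrite andbT eqxx andbT; case: eqP => _ /=; first by rewrite mul0r big1.
rewrite big_distrl/=; apply: eq_bigr => t _.
by rewrite !big_cons/= mulrA.
Qed.

Lemma off_diag_trace_pow (p n : nat) (X : 'M[R]_(p, n)) (A : 'M[R]_p) k :
  (forall i j, A i j = if i == j then 0 else \sum_t X i t * X j t) ->
  \tr (A ^+ k) =
  \sum_j \sum_(w <- walks 'I_p 'I_n k | walk_proper w j && (walk_start w j == j))
     \prod_(e <- walk_edges w j) X e.1 e.2.
Proof. by move=> AE; apply: eq_bigr => j _; exact: off_diag_pow_entry. Qed.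

End TraceExpansion.

Section EdgeWeights.
Variables (R : realFieldType) (S : eqType).

Lemma prod_count (es : seq S) (F : S -> R) :
  \prod_(e <- undup es) F e ^+ count_mem e es = \prod_(e <- es) F e.
Proof.
rewrite -[RHS]big_undup_iterop_count/=; apply: eq_bigr => e _.
by rewrite Monoid.iteropE -[RHS]/(iter _ _ _) iter_mulr_1.
Qed.

Lemma sum_count (es : seq S) : (\sum_(e <- undup es) count_mem e es = size es)%N.
Proof.
have := big_undup_iterop_count addn es xpredT (fun=> 1%N).
rewrite /= sum1_size => <-; apply: eq_bigr => e _.
by rewrite Monoid.iteropE iter_addn_0 mul1n.
Qed.

(** With [d0] or more distinct edges the common gain [D] suffices.  With fewer, the
multiplicities, which add up to at least [3 d0], cannot all be at most [3]: one
edge gains [H], and since there are at least two distinct edges another one gains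
[D]. *)
Lemma prod_edge_gain (g : nat -> R) (D H : R) (d0 : nat) (es : seq S) :
  0 <= D -> D <= 1 -> 0 <= H ->
  (forall m, (0 < m)%N -> 0 <= g m <= D) ->
  (forall m, (3 < m)%N -> g m <= H) ->
  D ^+ d0 <= H * D -> (3 * d0 <= size es)%N -> (1 < size (undup es))%N ->
  \prod_(e <- undup es) g (count_mem e es) <= H * D.
Proof.
move=> D0 D1 H0 gD gH dD ses1 ses2.
have cnt e : e \in undup es -> (0 < count_mem e es)%N.
  by rewrite mem_undup -has_pred1 has_count.
have le_pow (s : seq S) : {subset s <= undup es} ->
    \prod_(e <- s) g (count_mem e es) <= D ^+ size s.
  move=> ss; have -> : D ^+ size s = \prod_(e <- s) D.
    by rewrite big_const_seq count_predT iter_mulr_1.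
  rewrite big_seq [leRHS]big_seq.
  apply: ler_prod => e /ss /cnt; exact: gD.
have [dle|dlt] := leqP d0 (size (undup es)).
  apply: (le_trans (le_pow _ _)) => //; apply: le_trans dD.
  exact: ler_wiXn2l.
have [/hasP[e eu e4]|/hasPn no4] := boolP (has (fun e => (3 < count_mem e es)%N) (undup es)).
  rewrite (big_rem e eu)/=; apply: ler_pM.
  - by have /andP[] := gD _ (cnt _ eu).
  - rewrite big_seq; apply: prodr_ge0 => x /mem_rem /cnt /gD /andP[] //.
  - exact: gH.
  apply: (@le_trans _ _ (D ^+ size (rem e (undup es)))).
    by apply: le_pow => x; exact: mem_rem.
  rewrite size_rem//; case: (size _) ses2 => [|[|m]]// _.
  by rewrite /= exprS ler_piMr// exprn_ile1.
exfalso; move: ses1; rewrite -sum_count leqNgt => /negP; apply.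
apply: (@leq_ltn_trans (3 * size (undup es))%N); last by rewrite ltn_mul2l.
rewrite -sum1_size big_distrr/= big_seq [X in (_ <= X)%N]big_seq; apply: leq_sum => e /no4.
by rewrite -leqNgt muln1.
Qed.

End EdgeWeights.

(** * Spectrum of a symmetric matrix *)

Section SymmetricSpectrum.
Import complex.
Variable R : rcfType.
Local Notation toC := (real_complex R).

(** The spectral theorem over the complex extension of [R]: the matrix is unitarily
similar to a diagonal one with real entries, and these are eigenvalues over [R]
because being a root of the characteristic polynomial does not depend on the
field. *)
Lemma symmetric_spectrum n (M : 'M[R]_n) : M^T = M ->
  exists sp : 'I_n -> R,
    (forall l, eigenvalue M l <-> exists i, l = sp i) /\
    (forall k, \tr (M ^+ k) = \sum_i sp i ^+ k).
Proof.
move=> Msym; pose A := map_mx toC M.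
have Asym : A \is symmetricmx.
  by apply/is_hermitianmxP/matrixP => i j; rewrite expr0 scale1r !mxE/= -[in LHS]Msym mxE.
have Areal : A \is a mxOver Num.real.
  by apply/mxOverP => i j; rewrite mxE complex_real.
have := hermitian_spectral_diag_real (realsym_hermsym Asym Areal).
have /orthomx_spectralP := symmetric_normalmx Asym Areal.
have := spectral_unit A; move: (spectralmx A) (spectral_diag A) => Q D Qu AE Dreal.
have DE i : toC (complex.Re (D 0 i)) = D 0 i.
  by apply: RRe_real; apply/mxOverP.
exists (fun i => complex.Re (D 0 i)); split.
  move=> l; split.
    case/eigenvalueP => v vM v0.
    pose u := map_mx toC v *m invmx Q.
    have uD : u *m diag_mx D = toC l *: u.
      have : map_mx toC v *m A = toC l *: map_mx toC v.
        by rewrite -map_mxM vM map_mxZ.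
      move/(congr1 (mulmx^~ (invmx Q))); rewrite {1}AE !mulmxA mulmxK//.
      by rewrite -scalemxAl.
    have u0 : u != 0.
      apply: contra v0 => /eqP u0; rewrite -(map_mx_eq0 toC).
      by rewrite -[map_mx _ _](mulmxKV Qu) -/u u0 mul0mx.
    have [i ui] : exists i, u 0 i != 0.
      apply/existsP; apply: contraNT u0 => /existsPn u0.
      by apply/eqP/rowP => i; rewrite [RHS]mxE; apply/eqP; move: (u0 i); rewrite negbK.
    clearbody u; exists i; apply: (@complexI R); rewrite DE.
    move/rowP: uD => /(_ i); rewrite mul_mx_diag !mxE => H.
    by apply: (mulIf ui); rewrite -[RHS]mulrC H.
  move=> [i ->]; rewrite eigenvalue_root_char -(fmorph_root toC)/= DE map_char_poly.
  rewrite -eigenvalue_root_char; apply/eigenvalueP; exists (row i Q); last first.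
    apply/eqP => Qi0; have := Qu; rewrite -row_free_unit => /row_freeP[Q' QQ'].
    have := congr1 (row i) QQ'; rewrite row_mul Qi0 mul0mx => /rowP/(_ i).
    by rewrite !mxE eqxx => /esym/eqP; rewrite oner_eq0.
  have QA : Q *m A = diag_mx D *m Q by rewrite {1}AE !mulmxA mulmxV// mul1mx.
  by rewrite -/A -row_mul QA; apply/rowP => j; rewrite mul_diag_mx !mxE.
move=> k; apply: (@complexI R); rewrite [RHS]rmorph_sum/= -trace_map_mx.
have -> : map_mx toC (M ^+ k) = A ^+ k.
  elim: k => [|k IH]; first by rewrite !expr0; exact: map_mx1.
  by rewrite !exprS -!mulmxE map_mxM IH.
have -> : A ^+ k = invmx Q *m diag_mx D ^+ k *m Q.
  elim: k => [|k IH]; first by rewrite !expr0 mulmx1 mulVmx.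
  by rewrite !exprSr IH {1}AE -!mulmxE !mulmxA mulmxK.
rewrite -mulmxA mxtrace_mulC -mulmxA mulmxV// mulmx1.
have -> : diag_mx D ^+ k = diag_mx (\row_i D 0 i ^+ k).
  elim: k => [|k IH]; first by apply/matrixP => i j; rewrite !mxE ?expr0.
  rewrite exprS IH -mulmxE mulmx_diag; congr diag_mx.
  by apply/rowP => i; rewrite !mxE exprS.
rewrite mxtrace_diag; apply: eq_bigr => i _.
by rewrite mxE rmorphXn/= DE.
Qed.

End SymmetricSpectrum.

(** * The spectral norm through traces of Gram powers *)

Section SpectralNorm.
Variable R : realType.
Implicit Types (m n : nat).

(** If [v] is an eigenvector of [C^T C] for [l], then [l v v^T] is the square of the
Euclidean norm of [v C^T]. *)
Lemma gram_spectrum m n (C : 'M[R]_(m, n)) :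
  exists sp : 'I_n -> R,
    [/\ forall i, 0 <= sp i,
        forall l, eigenvalue (C^T *m C) l <-> exists i, l = sp i &
        forall k, \tr ((C^T *m C) ^+ k) = \sum_i sp i ^+ k].
Proof.
have Msym : (C^T *m C)^T = C^T *m C by rewrite trmx_mul trmxK.
have [sp [spE trE]] := symmetric_spectrum Msym; exists sp; split => // i.
have /spE/eigenvalueP[v vM v0] : exists j, sp i = sp j by exists i.
have sq k (u : 'rV[R]_k) : (u *m u^T) 0 0 = \sum_j u 0 j ^+ 2.
  by rewrite mxE; apply: eq_bigr => j _; rewrite mxE expr2.
have vv : 0 < \sum_j v 0 j ^+ 2.
  rewrite lt_def sumr_ge0 ?andbT => [|j _]; last exact: sqr_ge0.
  apply: contra v0; rewrite psumr_eq0 => [/allP v0|j _]; last exact: sqr_ge0.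
  apply/eqP/rowP => j; rewrite mxE; apply/eqP; rewrite -sqrf_eq0.
  by apply: v0; rewrite mem_index_enum.
have : 0 <= ((v *m C^T) *m (v *m C^T)^T) 0 0.
  by rewrite sq sumr_ge0// => j _; exact: sqr_ge0.
by rewrite trmx_mul trmxK mulmxA -[_ *m C]mulmxA vM -scalemxAl mxE sq pmulr_lge0.
Qed.

Lemma spectral_norm_ge0 m n (C : 'M[R]_(m, n)) : 0 <= spectral_norm C.
Proof.
rewrite /spectral_norm; set S := [set _ | _ in _].
have [->|/set0P[x Sx]] := eqVneq S set0; first by rewrite sup0.
have [hS|nS] := pselect (has_sup S); last by rewrite sup_out.
have [l _ lx] := Sx; apply: (@le_trans _ _ x); first by rewrite -lx sqrtr_ge0.
by apply: ub_le_sup => //; case: hS.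
Qed.

(** The trace of the [k]-th power lies between the [k]-th power of the largest
eigenvalue and [n] times that power; the factor [n] is lost as [k] grows.  The
right side is a countable family of polynomial conditions on the entries. *)
Lemma spectral_norm_leP m n (C : 'M[R]_(m, n)) (x : R) : 0 <= x ->
  spectral_norm C <= x <->
  forall k, \tr ((C^T *m C) ^+ k) <= n%:R * (x ^+ 2) ^+ k.
Proof.
move=> x0; have [sp [sp0 spE trE]] := gram_spectrum C.
have -> : spectral_norm C <= x <-> forall i, sp i <= x ^+ 2.
  rewrite /spectral_norm; set S := [set _ | _ in _].
  have SE y : S y <-> exists i, y = Num.sqrt (sp i).
    split=> [[l /= /spE[i ->] <-]|[i ->]]; first by exists i.
    by exists (sp i) => //=; apply/spE; exists i.
  split=> [Sx i|spx].
    rewrite -[leLHS](sqr_sqrtr (sp0 i)) lerXn2r ?nnegrE ?sqrtr_ge0//.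
    apply: le_trans Sx; apply: ub_le_sup; last by apply/SE; exists i.
    exists (Num.sqrt (\sum_j sp j)) => _ /SE[j ->].
    by rewrite ler_sqrt ?sumr_ge0// (bigD1 j)//= lerDl sumr_ge0.
  have [->|/set0P S0] := eqVneq S set0; first by rewrite sup0.
  apply: ge_sup => // _ /SE[i ->].
  by rewrite -(ger0_norm x0) -sqrtr_sqr ler_sqrt ?sqr_ge0.
split=> [spx k|trx i].
  rewrite trE -[n in n%:R]card_ord -sum1_card natr_sum mulr_suml.
  by apply: ler_sum => i _; rewrite mul1r lerXn2r ?nnegrE ?sqr_ge0.
rewrite leNgt; apply/negP => xsp.
have sp_gt0 : 0 < sp i by exact: le_lt_trans (sqr_ge0 x) xsp.
pose z := x ^+ 2 / sp i.
have z0 : 0 <= z by rewrite divr_ge0 ?sqr_ge0.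
have z1 : `|z| < 1 by rewrite ger0_norm// ltr_pdivrMr// mul1r.
have := cvg_expr z1 => /cvgrPdist_lt/(_ (n.+1%:R^-1)).
have n0 : 0 < n.+1%:R^-1 :> R by rewrite invr_gt0.
move=> /(_ n0)[k _ /(_ k (leqnn k))]; rewrite /= sub0r normrN ger0_norm ?exprn_ge0//.
apply/negP; rewrite -leNgt /z expr_div_n ler_pdivlMr ?exprn_gt0//.
rewrite mulrC ler_pdivrMr// [leRHS]mulrC.
apply: (@le_trans _ _ (n%:R * (x ^+ 2) ^+ k)); last first.
  by apply: ler_wpM2r; rewrite ?exprn_ge0 ?sqr_ge0// ler_nat.
apply: le_trans (trx k); rewrite trE (bigD1 i)//= lerDl.
by apply: sumr_ge0 => j _; exact: exprn_ge0.
Qed.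

Lemma spectral_norm_trace m n (C : 'M[R]_(m, n)) (y : R) k : 0 <= y ->
  y < spectral_norm C -> y ^+ (2 * k) <= \tr ((C^T *m C) ^+ k).
Proof.
move=> y0; have [sp [sp0 spE trE]] := gram_spectrum C.
rewrite /spectral_norm; set S := [set _ | _ in _] => ys.
have [x Sx yx] : exists2 x, S x & y < x.
  apply: contrapT => H; have : sup S <= y.
    have [->|/set0P S0] := eqVneq S set0; first by rewrite sup0.
    apply: ge_sup => // x Sx; rewrite leNgt; apply/negP => yx.
    by apply: H; exists x.
  by rewrite leNgt ys.
have [l /= /spE[i ->] xE] := Sx.
rewrite trE (bigD1 i)//= exprM; apply: (@le_trans _ _ (sp i ^+ k)); last first.
  by rewrite lerDl sumr_ge0// => j _; exact: exprn_ge0.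
apply: lerXn2r; rewrite ?nnegrE ?sqr_ge0// -[leRHS](sqr_sqrtr (sp0 i)) xE.
by rewrite lerXn2r ?nnegrE// ltW// (le_lt_trans y0).
Qed.

End SpectralNorm.

Section MeasurableMatrices.
Context d (T : measurableType d) (R : realType).

Definition measurable_mx m n (F : T -> 'M[R]_(m, n)) : Prop :=
  forall i j, measurable_fun setT (fun w => F w i j).

Lemma measurable_mx_mul m n q (F : T -> 'M[R]_(m, n)) (G : T -> 'M[R]_(n, q)) :
  measurable_mx F -> measurable_mx G -> measurable_mx (fun w => F w *m G w).
Proof.
move=> mF mG i j; rewrite (_ : (fun w => _) = fun w => \sum_l F w i l * G w l j).
  by apply: measurable_sum => l; exact: measurable_funM.
by apply/funext => w; rewrite mxE.
Qed.

Lemma measurable_mx_tr m n (F : T -> 'M[R]_(m, n)) :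
  measurable_mx F -> measurable_mx (fun w => (F w)^T).
Proof. by move=> mF i j; under eq_fun do rewrite mxE; exact: mF. Qed.

Lemma measurable_mx_pow n (F : T -> 'M[R]_n) k :
  measurable_mx F -> measurable_mx (fun w => F w ^+ k).
Proof.
move=> mF; elim: k => [|k IH] i j; first by under eq_fun do rewrite expr0; exact: measurable_cst.
under eq_fun do rewrite exprS; exact: measurable_mx_mul.
Qed.

Lemma measurable_mxtrace n (F : T -> 'M[R]_n) :
  measurable_mx F -> measurable_fun setT (fun w => \tr (F w)).
Proof. by move=> mF; apply: measurable_sum => i; exact: mF. Qed.

(** By the trace criterion the complement is a countable intersection of
measurable events. *)
Lemma measurable_spectral_norm_gt m n (F : T -> 'M[R]_(m, n)) (x : R) : 0 <= x ->
  measurable_mx F -> measurable [set w | x < spectral_norm (F w)].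
Proof.
move=> x0 mF.
have -> : [set w | x < spectral_norm (F w)] =
  ~` \bigcap_k [set w | \tr (((F w)^T *m F w) ^+ k) <= n%:R * (x ^+ 2) ^+ k].
  apply/seteqP; split => w /=.
    move=> xw H; move: xw; rewrite ltNge => /negP; apply; apply/spectral_norm_leP => // k.
    exact: H.
  move=> H; rewrite ltNge; apply/negP => /(spectral_norm_leP _ x0) H'.
  by apply: H => k _; exact: H'.
apply: measurableC; apply: bigcapT_measurable => k.
have mt : measurable_fun setT (fun w => \tr (((F w)^T *m F w) ^+ k)).
  apply: measurable_mxtrace; apply: measurable_mx_pow.
  by apply: measurable_mx_mul => //; exact: measurable_mx_tr.
rewrite (_ : [set _ | _] = (fun w => \tr (((F w)^T *m F w) ^+ k)) @^-1`
    `]-oo, n%:R * (x ^+ 2) ^+ k]).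
  by rewrite -[X in measurable X]setTI; exact: mt.
by apply/seteqP; split => w /=; rewrite in_itv.
Qed.

End MeasurableMatrices.

(** * Expected trace of the truncated matrix *)

Section ExpectedTrace.
Context d (T : measurableType d) (R : realType) (P : probability T R).

Local Notation Er f := (Rintegral P setT f).
Local Notation integrable f := (P.-integrable setT (EFin \o f)).

Lemma eq_distribution_expectation (X Y : {RV P >-> R}) (f : R -> R) :
  measurable_fun setT f ->
  (forall B, measurable B -> distribution P X B = distribution P Y B) ->
  integrable (f \o X) -> integrable (f \o Y) /\ Er (f \o Y) = Er (f \o X).
Proof.
move=> mf XY iX.
have mEf : measurable_fun setT (EFin \o f) by exact/measurable_EFinP.
have iY : integrable (f \o Y).
  apply/integrableP; split.
    by apply/measurable_EFinP; exact: measurableT_comp.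
  have /integrableP[_] := iX.
  have E (V : {RV P >-> R}) : (\int[P]_x `|(EFin \o (f \o V)) x| =
      \int[distribution P V]_y `|(f y)%:E|)%E.
    by rewrite ge0_integral_distribution//; exact: measurableT_comp.
  rewrite !E (eq_measure_integral (distribution P Y))// => A mA _.
  exact: XY.
split=> //; congr fine.
have E (V : {RV P >-> R}) : integrable (f \o V) ->
    (\int[P]_x (f (V x))%:E = \int[distribution P V]_y (f y)%:E)%E.
  by move=> iV; rewrite (integral_distribution mEf).
rewrite !E// (eq_measure_integral (distribution P X))// => A mA _.
exact: (esym (XY A mA)).
Qed.

Lemma stationary_distribution (Y : nat -> nat -> {RV P >-> R}) i t (B : set R) :
  strictly_stationary Y -> measurable B ->
  distribution P (Y 0%N 0%N) B = distribution P (Y i t) B.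
Proof.
move=> statY mB.
(* Stationarity is used for a single index, translated from the origin to [(i, t)]. *)
pose B1 : set (1.-tuple R) := (fun x => tnth x ord0) @^-1` B.
have mB1 : measurable B1.
  by rewrite -[B1]setTI; apply: measurable_tnth.
have := statY i t 1%N [tuple (0, 0)%N] B1 mB1.
rewrite /B1 /field_tuple /distribution /pushforward => H.
apply/esym; transitivity (P ((fun w : T => [tuple Y
    (tnth [tuple ((tnth [tuple (0%N, 0%N)] j).1 + i, (tnth [tuple (0%N, 0%N)] j).2 + t)%N | j < 1] j).1
    (tnth [tuple ((tnth [tuple (0%N, 0%N)] j).1 + i, (tnth [tuple (0%N, 0%N)] j).2 + t)%N | j < 1] j).2 w | j < 1]) @^-1`
    ((fun x : 1.-tuple R => tnth x ord0) @^-1` B))).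
  by congr (P _); apply/seteqP; split => w /=; rewrite !tnth_mktuple.
rewrite H; congr (P _).
by apply/seteqP; split => w /=; rewrite !tnth_mktuple.
Qed.

(** The product is at most the corresponding power of its largest factor. *)
Lemma prod_le_sum_pow (S : eqType) (s : seq S) (x : S -> R) :
  (0 < size s)%N -> (forall e, 0 <= x e) ->
  \prod_(e <- s) x e <= \sum_(e <- s) x e ^+ size s.
Proof.
move=> s0 x0.
have [e es emax] : exists2 e, e \in s & forall e', e' \in s -> x e' <= x e.
  elim: s s0 => // e [|e' s] IH _.
    by exists e; rewrite ?mem_head// => e'; rewrite inE => /eqP->.
  have [//|m ms mmax] := IH.
  have [em|me] := leP (x e) (x m).
    by exists m; [rewrite inE ms orbT|move=> y; rewrite inE => /orP[/eqP->//|/mmax]].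
  exists e; first exact: mem_head.
  by move=> y; rewrite inE => /orP[/eqP->//|/mmax H]; exact: le_trans H (ltW me).
apply: (@le_trans _ _ (x e ^+ size s)).
  have -> : x e ^+ size s = \prod_(e' <- s) x e.
    by rewrite big_const_seq count_predT iter_mulr_1.
  by rewrite big_seq [leRHS]big_seq; apply: ler_prod => y ys; rewrite x0 emax.
by rewrite (big_rem e es)/= lerDl sumr_ge0// => y _; exact: exprn_ge0.
Qed.

Variables (sigma Z : nat -> nat -> {RV P >-> R}).
Hypothesis sigma_ge0 : forall i t w, 0 <= sigma i t w.
Hypothesis sigma_stationary : strictly_stationary sigma.
Hypothesis sigma_moments : forall r : R, 0 < r ->
     ('E_P[(fun w => sigma 0%N 0%N w `^ r)%R] < +oo)%E.

Lemma sigma_pow_integrable m : (0 < m)%N -> integrable (fun w => sigma 0%N 0%N w ^+ m).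
Proof.
move=> m0; apply/integrableP; split.
  by apply/measurable_EFinP; exact: measurable_funX.
have := sigma_moments (_ : 0 < m%:R); rewrite ltr0n => /(_ m0).
rewrite unlock; congr (_ < _)%E; apply: eq_integral => w _.
by rewrite gee0_abs ?lee_fin ?exprn_ge0//= powR_mulrn.
Qed.

(** The volatilities may be arbitrarily dependent; dominating the product by power
sums leaves a quantity which depends on their common law only. *)
Lemma sigma_prod_expectation (es : seq (nat * nat)) : (0 < size es)%N ->
  integrable (fun w => \prod_(e <- es) sigma e.1 e.2 w) /\
  Er (fun w => \prod_(e <- es) sigma e.1 e.2 w) <=
    (size es)%:R * Er (fun w => sigma 0%N 0%N w ^+ size es).
Proof.
move=> s0.
have i0 := sigma_pow_integrable s0.
have pw e : integrable (fun w => sigma e.1 e.2 w ^+ size es) /\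
    Er (fun w => sigma e.1 e.2 w ^+ size es) = Er (fun w => sigma 0%N 0%N w ^+ size es).
  apply: (@eq_distribution_expectation (sigma 0%N 0%N) (sigma e.1 e.2)
    (fun x => x ^+ size es)) => //.
  by move=> B mB; exact: stationary_distribution.
have sumE (s : seq (nat * nat)) :
    integrable (fun w => \sum_(e <- s) sigma e.1 e.2 w ^+ size es) /\
    Er (fun w => \sum_(e <- s) sigma e.1 e.2 w ^+ size es) =
    (size s)%:R * Er (fun w => sigma 0%N 0%N w ^+ size es).
  elim: s => [|e s [IH1 IH2]].
    under eq_fun do rewrite big_nil.
    split; first exact: finite_measure_integrable_cst.
    by rewrite mul0r expectation_const.
  under eq_fun do rewrite big_cons.
  have [p1 p2] := pw e.
  split; first exact: (integrableD measurableT p1 IH1).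
  by rewrite RintegralD// IH2 p2 /= -[in RHS]natr1 mulrDl mul1r addrC.
have [S1 S2] := sumE es.
have ip : integrable (fun w => \prod_(e <- es) sigma e.1 e.2 w).
  apply: (le_integrable measurableT _ _ S1).
    by apply/measurable_EFinP; apply: measurable_prod.
  move=> w _; rewrite /= lee_fin ger0_norm ?prodr_ge0//.
  by rewrite (le_trans _ (ler_norm _))// prod_le_sum_pow.
by split=> //; rewrite -S2; apply: le_Rintegral => // w _; exact: prod_le_sum_pow.
Qed.

Hypothesis Z_iid : iid_field Z.
Hypothesis sigma_Z_indep : independent_fields sigma Z.

(** Separate the two fields, then group equal edges: the truncated noise contributes
one moment per distinct edge, of order the multiplicity of that edge. *)
Lemma edges_expectation (b : R) (V : nat -> R) (es : seq (nat * nat)) :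
  0 <= b -> (0 < size es)%N ->
  (forall m, (0 < m)%N -> `|Er (fun w => truncate b (Z 0%N 0%N w) ^+ m)| <= V m) ->
  let F w := \prod_(e <- es) (sigma e.1 e.2 w * truncate b (Z e.1 e.2 w)) in
  integrable F /\
  Er F <= (size es)%:R * Er (fun w => sigma 0%N 0%N w ^+ size es) *
          \prod_(e <- undup es) V (count_mem e es).
Proof.
move=> b0 s0 HV F.
have [indZ idZ] := Z_iid.
pose f (e : nat * nat) (z : R) := truncate b z ^+ count_mem e es.
have mf e : measurable_fun setT (f e).
  by apply: measurable_funX; exact: measurable_truncate.
pose M := Num.max 1 b ^+ size es.
have fM e z : `|f e z| <= M.
  rewrite normrX; have m1 : 1 <= Num.max 1 b by rewrite le_max lexx.
  apply: (@le_trans _ _ (Num.max 1 b ^+ count_mem e es)).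
    rewrite lerXn2r ?nnegrE// ?(le_trans ler01 m1)//.
    by rewrite (le_trans (normr_truncate_le z b0))// le_max lexx orbT.
  by rewrite ler_weXn2l// count_size.
have [iU EU] := independent_prod_expectation indZ mf fM (undup_uniq es).
have [iS ES] := sigma_prod_expectation s0.
have FE : F = fun w => (\prod_(e <- es) sigma e.1 e.2 w) *
                       (\prod_(e <- undup es) f e (Z e.1 e.2 w)).
  apply/funext => w; rewrite /F big_split/=; congr (_ * _).
  by rewrite -(prod_count es (fun e => truncate b (Z e.1 e.2 w))).
have := @independent_fields_expectation _ _ _ P sigma Z _ es (undup es)
  (fun=> id) f id id sigma_Z_indep (fun=> @measurable_id _ _ setT) mf iS iU.
rewrite -FE => -[iF ->]; split => //.
apply: (le_trans (ler_norm _)); rewrite normrM; apply: ler_pM => //.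
  rewrite ger0_norm// Rintegral_ge0// => w _; exact: prodr_ge0.
rewrite EU normr_prod [leLHS]big_seq [leRHS]big_seq; apply: ler_prod => e.
rewrite mem_undup => ees; rewrite normr_ge0/=.
have c0 : (0 < count_mem e es)%N by rewrite -has_count has_pred1.
have [_] := @eq_distribution_expectation (Z 0%N 0%N) (Z e.1 e.2) (f e) (mf e)
  (fun B mB => esym (idZ e.1 e.2 B mB)) (truncX_integrable _ _ b0).
by rewrite /comp => ->; exact: HV.
Qed.

Definition truncated_matrix (b : R) p n w : 'M[R]_(p, n) :=
  \matrix_(i < p, t < n) (sigma i t w * truncate b (Z i t w)).

Definition off_diag p n (X : 'M[R]_(p, n)) : 'M[R]_p := X *m X^T - diag_part (X *m X^T).

(** Here [q] is the weight of a distinct edge in the count of walks, [q0] the factor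
that the moments provide for such an edge, and [Lam] the loss from [q] to [q0].
Every edge of multiplicity [m] moreover brings [B^m] and the gain [g m], which is
at most [D], and at most [H] once [m > 3]. *)
Lemma expected_trace_le (b : R) (g : nat -> R) (q q0 Lam B C D H : R) (p n d0 K : nat) :
  0 <= b -> 0 <= q -> q <= 1 -> n%:R * p%:R * q ^+ 2 <= 1 -> p%:R * q <= 1 ->
  0 <= q0 -> q0 <= q * Lam -> 1 <= Lam -> 0 <= B -> 1 <= C ->
  0 <= D -> D <= 1 -> 0 <= H ->
  (forall m, (0 < m)%N -> 0 <= g m <= D) -> (forall m, (3 < m)%N -> g m <= H) ->
  D ^+ d0 <= H * D -> (3 * d0 <= 2 * K)%N -> (0 < K)%N ->
  (forall m, (0 < m)%N -> `|Er (fun w => truncate b (Z 0%N 0%N w) ^+ m)| <=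
     q0 * C * B ^+ m * g m) ->
  let F w := \tr (off_diag (truncated_matrix b p n w) ^+ K) in
  integrable F /\
  Er F <= ((2 * K)%:R * Er (fun w => sigma 0%N 0%N w ^+ (2 * K))) *
     (C ^+ (2 * K) * B ^+ (2 * K) * Lam ^+ (2 * K) * (H * D)) *
     ((\prod_(i < K) (4 * i + 1)%N)%:R * p%:R).
Proof.
move=> b0 q_ge0 q_le1 npq pq q00 q0q Lam1 B0 C1 D0 D1 H0 gD gH dD dK K0 HV F.
pose Ms := (2 * K)%:R * Er (fun w => sigma 0%N 0%N w ^+ (2 * K)).
have Ms0 : 0 <= Ms.
  by rewrite mulr_ge0// Rintegral_ge0// => w _; exact: exprn_ge0.
pose Q := C ^+ (2 * K) * B ^+ (2 * K) * Lam ^+ (2 * K) * (H * D).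
have C0 : 0 <= C by exact: le_trans C1.
have Lam0 : 0 <= Lam by exact: le_trans Lam1.
have Q0 : 0 <= Q by rewrite !mulr_ge0 ?exprn_ge0.
pose emb (e : 'I_p * 'I_n) : nat * nat := (val e.1, val e.2).
(* The fields are indexed by pairs of naturals, so edges are sent there injectively. *)
have emb_inj : injective emb.
  by move=> [i t] [i' t'] [/val_inj-> /val_inj->].
pose term w0 j w := \prod_(e <- map emb (walk_edges w0 j))
  (sigma e.1 e.2 w * truncate b (Z e.1 e.2 w)).
have termP w0 j : w0 \in walks 'I_p 'I_n K -> walk_proper w0 j ->
    integrable (term w0 j) /\
    Er (term w0 j) <= Ms * Q * q ^+ size (undup (walk_edges w0 j)).
  move=> wK pw; set es := map emb (walk_edges w0 j).
  have ses : size es = (2 * K)%N by rewrite size_map size_walk_edges (walks_size wK) mul2n.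
  have ues : undup es = map emb (undup (walk_edges w0 j)) by rewrite undup_map_inj.
  have sues : size (undup es) = size (undup (walk_edges w0 j)) by rewrite ues size_map.
  have s0 : (0 < size es)%N by rewrite ses muln_gt0.
  have [iT ET] := edges_expectation b0 s0 HV.
  split=> //; apply: (le_trans ET); rewrite ses -/Ms -mulrA; apply: ler_wpM2l => //.
  rewrite -sues; set dd := size (undup es).
  have dd2K : (dd <= 2 * K)%N by rewrite -ses size_undup.
  rewrite !big_split/= prod_count.
  have cst (x : R) (s : seq (nat * nat)) : \prod_(e <- s) x = x ^+ size s.
    by rewrite big_const_seq count_predT iter_mulr_1.
  rewrite !cst ses -/dd.
  have gain : \prod_(e <- undup es) g (count_mem e es) <= H * D.
    apply: (prod_edge_gain D0 D1 H0 gD gH dD); rewrite ?ses//.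
    by rewrite sues walk_edges_distinct// (walks_size wK).
  rewrite /Q.
  (* There are [dd] distinct edges, whereas the multiplicities add up to [2 K]. *)
  apply: (@le_trans _ _ ((q * Lam) ^+ dd * C ^+ dd * B ^+ (2 * K) * (H * D))).
    apply: ler_pM => //.
    - by rewrite !mulr_ge0 ?exprn_ge0.
    - rewrite big_seq; apply: prodr_ge0 => e.
      rewrite mem_undup -has_pred1 has_count => /gD/andP[] //.
    apply: ler_wpM2r; first exact: exprn_ge0.
    apply: ler_wpM2r; first exact: exprn_ge0.
    by rewrite lerXn2r ?nnegrE// mulr_ge0.
  rewrite exprMn.
  apply: (@le_trans _ _ (q ^+ dd * Lam ^+ (2 * K) * C ^+ (2 * K) * B ^+ (2 * K) * (H * D))).
    do 2 (apply: ler_wpM2r; first by rewrite ?mulr_ge0 ?exprn_ge0).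
    apply: ler_pM; rewrite ?mulr_ge0 ?exprn_ge0// ?ler_weXn2l//.
    by apply: ler_wpM2l; rewrite ?exprn_ge0// ler_weXn2l.
  by rewrite le_eqVlt; apply/orP; left; apply/eqP; ring.
have FE : F = fun w => \sum_(j < p) \sum_(w0 <- walks 'I_p 'I_n K |
    walk_proper w0 j && (walk_start w0 j == j)) term w0 j w.
  apply/funext => w; rewrite /F (@off_diag_trace_pow _ _ _ (truncated_matrix b p n w)).
    apply: eq_bigr => j _; apply: eq_bigr => w0 _.
    by rewrite /term big_map; apply: eq_bigr => e _; rewrite mxE.
  by move=> i j; exact: off_diag_entry.
have sumP (S : eqType) (s : seq S) (c : pred S) (G : S -> T -> R) (v : S -> R) :
    (forall x, x \in s -> c x -> integrable (G x) /\ Er (G x) <= v x) ->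
    integrable (fun w => \sum_(x <- s | c x) G x w) /\
    Er (fun w => \sum_(x <- s | c x) G x w) <= \sum_(x <- s | c x) v x.
  elim: s => [|x s IH] HG.
    under eq_fun do rewrite big_nil.
    split; first exact: finite_measure_integrable_cst.
    by rewrite big_nil expectation_const.
  have [i1 i2] := IH (fun y ys => HG y (@mem_behead _ (x :: s) y ys)).
  rewrite big_cons; case: ifP => cx; under eq_fun do rewrite big_cons cx; last by [].
  have [g1 g2] := HG x (mem_head _ _) cx.
  split; first exact: (integrableD measurableT g1 i1).
  by rewrite RintegralD// lerD.
have [iF EF] := @sumP _ (index_enum 'I_p) xpredT
  (fun j w => \sum_(w0 <- walks 'I_p 'I_n K |
    walk_proper w0 j && (walk_start w0 j == j)) term w0 j w)
  (fun j => \sum_(w0 <- walks 'I_p 'I_n K |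
    walk_proper w0 j && (walk_start w0 j == j))
     Ms * Q * q ^+ size (undup (walk_edges w0 j)))
  (fun j _ _ => @sumP _ (walks 'I_p 'I_n K)
     (fun w0 => walk_proper w0 j && (walk_start w0 j == j)) (fun w0 => term w0 j) _
     (fun w0 wK pw => termP w0 j wK (andP pw).1)).
rewrite FE; split => //; apply: (le_trans EF).
have := @sum_walks_distinct_edges 'I_p 'I_n R q K q_ge0 q_le1.
rewrite !card_ord => /(_ npq pq) W.
apply: (le_trans _ (ler_wpM2l (mulr_ge0 Ms0 Q0) W)).
rewrite mulr_sumr; apply: ler_sum => j _; rewrite mulr_sumr.
rewrite big_mkcond [leRHS]big_mkcond; apply: ler_sum => w0 _.
case: (walk_proper w0 j) => //=; case: ifP => // _.
exact: (mulr_ge0 (mulr_ge0 Ms0 Q0) (exprn_ge0 _ q_ge0)).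
Qed.

End ExpectedTrace.

(** * From the trace to the tail of the norm *)

Section TailOfSpectralNorm.
Context d (T : measurableType d) (R : realType) (P : probability T R).
Variables (sigma Z : nat -> nat -> {RV P >-> R}).

Local Notation Er f := (Rintegral P setT f).
Local Notation integrable f := (P.-integrable setT (EFin \o f)).

Lemma off_diag_sym p n (X : 'M[R]_(p, n)) : (off_diag X)^T = off_diag X.
Proof.
rewrite /off_diag /diag_part linearB/= trmx_mul trmxK; congr (_ - _).
exact: tr_diag_mx.
Qed.

Lemma off_diag_gram_pow p n (X : 'M[R]_(p, n)) k :
  ((off_diag X)^T *m off_diag X) ^+ k = off_diag X ^+ (2 * k).
Proof. by rewrite off_diag_sym exprM expr2 mulmxE. Qed.

Lemma measurable_off_diag p n (X : T -> 'M[R]_(p, n)) :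
  measurable_mx X -> measurable_mx (fun w => off_diag (X w)).
Proof.
move=> mX i j.
have mS := measurable_mx_mul mX (measurable_mx_tr mX).
rewrite (_ : (fun w => _) = fun w =>
    (X w *m (X w)^T) i j - (i == j)%:R * (X w *m (X w)^T) i i).
  by apply: measurable_funB => //; exact: measurable_funM.
apply/funext => w; rewrite /off_diag /diag_part; move: (X w *m _) => S.
by rewrite !mxE mulr_natl.
Qed.

Lemma measurable_sv_matrix p n : measurable_mx (fun w => sv_matrix sigma Z p n w).
Proof. by move=> i t; under eq_fun do rewrite mxE; exact: measurable_funM. Qed.

Hypothesis Z_id : identically_distributed Z.

Lemma exceedance_probability i t (b : R) :
  P [set w | b < `|Z i t w|] = (abs_tail (Z 0%N 0%N) b)%:E.
Proof.
rewrite abs_tailE.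
have mB : measurable [set x : R | b < `|x|].
  have mn : measurable_fun setT (fun x : R => `|x|) by exact: measurableT_comp.
  rewrite (_ : [set _ | _] = (fun x : R => `|x|) @^-1` `]b, +oo[).
    by rewrite -[X in measurable X]setTI; exact: mn.
  by apply/seteqP; split => w /=; rewrite in_itv/= andbT.
exact: (Z_id i t mB).
Qed.

Lemma some_exceedance_probability p n (b : R) :
  (P (\big[setU/set0]_(i < p) \big[setU/set0]_(t < n) [set w | (b < `|Z i t w|)%R]) <=
   ((n * p)%:R * abs_tail (Z 0%N 0%N) b)%:E)%E.
Proof.
have mE i t : measurable [set w | b < `|Z i t w|] by exact: measurable_abs_gt.
apply: (le_trans (Boole_inequality P (A := fun i =>
  \big[setU/set0]_(t < n) [set w | b < `|Z i t w|]) _)) => [i _|].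
  exact: bigsetU_measurable.
apply: (@le_trans _ _ (\sum_(i < p) (n%:R * abs_tail (Z 0%N 0%N) b)%:E)%E).
  apply: lee_sum => i _.
  apply: (le_trans (Boole_inequality P (A := fun t => [set w | b < `|Z i t w|]) _)) => [t _//|].
  rewrite (eq_bigr (fun=> (abs_tail (Z 0%N 0%N) b)%:E)) => [|t _]; last first.
    exact: exceedance_probability.
  by rewrite sumEFin lee_fin sumr_const card_ord mulr_natl.
by rewrite sumEFin lee_fin sumr_const card_ord -[leLHS]mulr_natl natrM mulrA [p%:R * _]mulrC.
Qed.

(** Unless some [|Z_it|] exceeds [b], truncation does not change the matrix, and then
the norm is controlled by the trace of an even power, to which Markov's inequality
applies. *)
Lemma off_diag_norm_tail (b y : R) p n k : 0 < y ->
  let F w := \tr (off_diag (truncated_matrix sigma Z b p n w) ^+ (2 * k)) in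
  integrable F ->
  (P [set w | (y < spectral_norm (off_diag (sv_matrix sigma Z p n w)))%R] <=
   ((n * p)%:R * abs_tail (Z 0%N 0%N) b + Er F / y ^+ (2 * k))%:E)%E.
Proof.
move=> y0 F iF.
have F0 w : 0 <= F w.
  rewrite /F -off_diag_gram_pow.
  have [sp [sp0 _ ->]] := gram_spectrum (off_diag (truncated_matrix sigma Z b p n w)).
  by apply: sumr_ge0 => i _; exact: exprn_ge0.
pose E1 : set T :=
  \big[setU/set0]_(i < p) \big[setU/set0]_(t < n) [set w | b < `|Z i t w|].
pose E2 : set T := [set w | y ^+ (2 * k) <= F w].
have mF : measurable_fun setT F by apply/measurable_EFinP; case/integrableP: iF.
have mE1 : measurable E1.
  by do 2 (apply: bigsetU_measurable => ? _); exact: measurable_abs_gt.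
have mE2 : measurable E2.
  rewrite (_ : E2 = F @^-1` `[y ^+ (2 * k), +oo[).
    by rewrite -[X in measurable X]setTI; exact: mF.
  by apply/seteqP; split => w /=; rewrite in_itv/= andbT.
have sub : [set w | y < spectral_norm (off_diag (sv_matrix sigma Z p n w))] `<=` E1 `|` E2.
  move=> w /= yw; have [|nE1] := pselect (E1 w); [by left|right].
  have XE : sv_matrix sigma Z p n w = truncated_matrix sigma Z b p n w.
    apply/matrixP => i t; rewrite !mxE /truncate; case: ifPn => //.
    rewrite -ltNge => bz; exfalso; apply: nE1.
    rewrite /E1 -(bigcup_mkord p (fun i =>
      \big[setU/set0]_(t < n) [set w | b < `|Z i t w|])).
    exists (val i) => /=; first exact: ltn_ord.
    rewrite -(bigcup_mkord n (fun t => [set w | b < `|Z i t w|])).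
    by exists (val t) => //=; exact: ltn_ord.
  rewrite /E2 /F /= -off_diag_gram_pow -XE.
  exact: (spectral_norm_trace _ (ltW y0)).
apply: (@le_trans _ _ (P (E1 `|` E2))).
  apply: le_measure; rewrite ?inE//; last exact: measurableU.
  apply: measurable_spectral_norm_gt; first exact: ltW.
  by apply: measurable_off_diag; exact: measurable_sv_matrix.
apply: (le_trans (measureU2 _ mE1 mE2)).
rewrite EFinD; apply: leeD; first exact: some_exceedance_probability.
have fE2 : P E2 \is a fin_num by exact: fin_num_measure.
apply: (@le_trans _ _ (fine (P E2))%:E); first by rewrite fineK.
rewrite lee_fin ler_pdivlMr ?exprn_gt0// mulrC.
have iI : integrable (\1_E2 : T -> R) by exact: integrable_indic.
have -> : fine (P E2) = Er (\1_E2 : T -> R) by rewrite /Rintegral integral_indic// setIT.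
rewrite -RintegralZl//; apply: le_Rintegral => //.
  exact: (integrableZl measurableT (y ^+ (2 * k)) iI).
move=> w _ /=; rewrite ?indicE; case: (boolP (w \in E2)) => [/set_mem wE2|_].
  by rewrite mulr1; exact: wE2.
by rewrite mulr0; exact: F0.
Qed.

End TailOfSpectralNorm.

(** * Exponents and the rate of the expected trace *)

Section Exponents.
Variable R : realType.

Lemma powR_exprn (x t : R) m : (x `^ t) ^+ m = x `^ (t * m%:R).
Proof. by rewrite powRrM powR_mulrn// powR_ge0. Qed.

Lemma powR_addn (x s t : R) : 0 < x -> x `^ s * x `^ t = x `^ (s + t).
Proof. by move=> x0; rewrite powRD// (gt_eqF x0) implybT. Qed.

(** The bound on the truncated moment of order [m] at the level [x^s], relative to
[x^(-1/2) (x^s)^m]: what an edge of multiplicity [m] saves beyond the weight that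
the count of walks requires. *)
Definition moment_gain (x s k : R) (m : nat) : R :=
  x `^ (1 / 2) * (if (m == 1%N) || (k <= m%:R) then (x `^ s) `^ (m%:R - k) else 1) /
  (x `^ s) ^+ m.

(** As [k s = 1], the bound [(x^s)^(m-k)] is [(x^s)^m / x], which leaves the gain
[x^(-1/2)].  The moments bounded by a constant have [m >= 2], and leave
[x^(1/2 - s m)]. *)
Lemma moment_gain_bounds (x s k dl : R) : 1 <= x -> 0 < k -> k < 4 -> k * s = 1 ->
  dl <= 1 / 2 -> dl <= 2 * s - 1 / 2 ->
  (forall m, (0 < m)%N -> 0 <= moment_gain x s k m <= x `^ (- dl)) /\
  (forall m, (3 < m)%N -> moment_gain x s k m <= x `^ (- (1 / 2))).
Proof.
move=> x1 k0 k4 ks dl1 dl2.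
have x0 : 0 < x by exact: lt_le_trans x1.
have s0 : 0 < s by rewrite -(pmulr_rgt0 _ k0) ks.
have high m : (m == 1%N) || (k <= m%:R) -> moment_gain x s k m = x `^ (- (1 / 2)).
  move=> mk; rewrite /moment_gain mk -powRrM powR_exprn -powRN !powR_addn//.
  congr (_ `^ _); have -> : s * (m%:R - k) = s * m%:R - 1 by rewrite -ks; ring.
  by field.
split=> m m0; last first.
  rewrite high//; apply/orP; right; apply: (le_trans (ltW k4)).
  by rewrite (ler_nat _ 4).
rewrite /moment_gain mulr_ge0 ?mulr_ge0 ?powR_ge0 ?invr_ge0 ?exprn_ge0 ?powR_ge0//=; last first.
  by case: ifP => // _; exact: powR_ge0.
have [mk|/norP[m1 mk]] := boolP ((m == 1%N) || (k <= m%:R)).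
  have := high m mk; rewrite /moment_gain mk => ->.
  by apply: ler_powR => //; lra.
rewrite mulr1 powR_exprn -powRN powR_addn//; apply: ler_powR => //.
have m2 : 2 <= m%:R :> R by rewrite ler_nat; case: m m0 m1 {mk} => [|[|]].
have : 2 * s <= s * m%:R by rewrite mulrC ler_pM2l.
lra.
Qed.

End Exponents.

Lemma cvg_probability0 (R : realType) (u : nat -> \bar R) : (forall n, (0 <= u n)%E) ->
  (forall e : R, 0 < e -> \forall n \near \oo, (u n <= e%:E)%E) ->
  u n @[n --> \oo] --> 0%E.
Proof.
move=> u0 H; apply/fine_cvgP; split.
  have := H 1 ltr01; apply: filterS => n un.
  by rewrite ge0_fin_numE// (le_lt_trans un)// ltry.
apply/cvgr0Pnorm_le => e e0; have := H e e0; apply: filterS => n un.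
rewrite /= ger0_norm ?fine_ge0// -lee_fin fineK//.
by rewrite ge0_fin_numE// (le_lt_trans un)// ltry.
Qed.

Lemma powR_neg_eventually_le (R : realType) (g c : R) : 0 < g -> 0 < c ->
  \forall x \near +oo, x `^ (- g) <= c.
Proof.
move=> g0 c0; have H := powR_eventually_ge c^-1 g0.
near=> x; have : c^-1 <= x `^ g by near: x.
rewrite powRN => cx; rewrite -[leRHS]invrK lef_pV2 ?posrE ?invr_gt0//.
by apply: lt_le_trans cx; rewrite invr_gt0.
Unshelve. all: by end_near. Qed.

(** Indeed [p^2 <= p n n^eta <= (n p)^(1 + eta)]. *)
Lemma dimension_bound (R : realType) (n p : nat) (eta : R) :
  0 < eta -> (0 < n)%N -> (0 < p)%N -> p%:R <= n%:R `^ (1 + eta) ->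
  p%:R <= (n * p)%:R `^ ((1 + eta) / 2) :> R.
Proof.
move=> eta0 n0 p0 pn.
have nN : n%:R <= (n * p)%:R :> R by rewrite ler_nat leq_pmulr.
rewrite -(@ler_pXn2r _ 2)// ?nnegrE ?powR_ge0// powR_exprn divfK ?pnatr_eq0//.
rewrite expr2; apply: (@le_trans _ _ (p%:R * n%:R `^ (1 + eta))); first exact: ler_wpM2l.
have split1 (x : R) : 0 < x -> x `^ (1 + eta) = x * x `^ eta.
  by move=> x0; rewrite -(powR_addn _ _ x0) powRr1// ltW.
rewrite !split1 ?ltr0n ?muln_gt0 ?n0//.
rewrite mulrA [p%:R * _]mulrC -natrM; apply: ler_wpM2l => //.
by apply: ge0_ler_powR; rewrite ?nnegrE// ltW.
Qed.

(** The exponents [s] and [r] of the truncation level and of the lower bound on [a]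
enclose [1/alpha] at distance [eta].  The gain per edge is [dl], positive because
[alpha < 4], and [d0] edges gain a full power.  The trace power is [2 d0]; the last
inequality says that all losses, which are multiples of [eta], stay below [dl].
The moment [kap = 1/s] exists since [kap < alpha], and [kap'] is between them. *)
Lemma exponent_choice (R : realType) (alpha : R) : 0 < alpha -> alpha < 4 ->
  exists (d0 : nat) (dl eta s r kap kap' : R),
    [/\ [/\ (0 < d0)%N, 1 <= d0%:R * dl, 0 < dl & dl <= 1 / 2],
        [/\ dl <= 2 * s - 1 / 2, 0 < eta, 0 < s, 0 < r & r * alpha < 1],
        [/\ 0 < kap, kap < 4 & kap * s = 1],
        [/\ kap < kap', kap' < alpha & 1 < s * kap'] &
        (2 * (2 * d0))%:R * (s - r) + eta * (2 * d0)%:R + eta / 2 < dl].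
Proof.
move=> alpha0 alpha4.
pose dl : R := Num.min (1 / 2) (2 / alpha - 1 / 2).
have dl0 : 0 < dl.
  rewrite lt_min; apply/andP; split; first lra.
  by rewrite subr_gt0 ltr_pdivlMr//; lra.
have dl_half : dl <= 1 / 2 by rewrite ge_min lexx.
have dl_alpha : dl <= 2 / alpha - 1 / 2 by rewrite ge_min lexx orbT.
pose d0 := (Num.truncn dl^-1).+1.
have d0dl : 1 <= d0%:R * dl by rewrite -ler_pdivrMr// div1r ltW// truncnS_gt.
have d00 : (0 < d0)%N by [].
clearbody d0.
pose K : R := (2 * d0)%:R.
have K1 : 1 <= K by rewrite (ler_nat R 1) muln_gt0.
have K0 : 0 < K by exact: lt_le_trans K1.
pose eta : R := Num.min (dl / (12 * K)) (1 / (2 * alpha)).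
have eta0 : 0 < eta by rewrite lt_min !divr_gt0 ?mulr_gt0.
have eta_dl : eta * (12 * K) <= dl by rewrite -ler_pdivlMr ?mulr_gt0// ge_min lexx.
have eta_alpha : eta <= 1 / (2 * alpha) by rewrite ge_min lexx orbT.
clearbody dl eta.
have ia0 : 0 < 1 / alpha by rewrite divr_gt0.
have ia : 1 / alpha * alpha = 1 by rewrite divfK// gt_eqF.
have ia2 : 1 / (2 * alpha) = (1 / alpha) / 2 by field; rewrite gt_eqF.
pose s := 1 / alpha + eta; pose r := 1 / alpha - eta.
have s0 : 0 < s by rewrite addr_gt0.
have r0 : 0 < r by rewrite /r; lra.
have kaps : s^-1 * s = 1 by rewrite mulVf// gt_eqF.
have kap_alpha : s^-1 < alpha.
  by rewrite -(ltr_pM2r s0) kaps -[ltLHS]ia [ltLHS]mulrC ltr_pM2l// /s; lra.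
exists d0, dl, eta, s, r, s^-1, ((s^-1 + alpha) / 2); split.
- by [].
- split=> //; last by rewrite -[ltRHS]ia ltr_pM2r// /r; lra.
  apply: (le_trans dl_alpha); have -> : 2 / alpha = 2 * (1 / alpha) by ring.
  by rewrite /s; lra.
- by split=> //; [rewrite invr_gt0|exact: lt_trans alpha4].
- split; [lra|lra|].
  by rewrite -[ltLHS]kaps mulrC ltr_pM2l//; lra.
rewrite natrM -/K /s /r.
have : eta <= eta * K by apply: ler_peMr => //; exact: ltW.
have -> : 2 * K * (1 / alpha + eta - (1 / alpha - eta)) = 4 * (eta * K) by ring.
have : eta * (12 * K) = 12 * (eta * K) by ring.
have : 0 < eta * K by rewrite mulr_gt0.
by move: (eta * K) eta_dl => z; lra.
Qed.

Section TraceRate.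
Context d (T : measurableType d) (R : realType) (P : probability T R).
Variables (sigma Z : nat -> nat -> {RV P >-> R}).
Hypothesis sigma_ge0 : forall i t w, 0 <= sigma i t w.
Hypothesis sigma_stationary : strictly_stationary sigma.
Hypothesis sigma_moments : forall r : R, 0 < r ->
     ('E_P[(fun w => sigma 0%N 0%N w `^ r)%R] < +oo)%E.
Hypothesis Z_iid : iid_field Z.
Hypothesis sigma_Z_indep : independent_fields sigma Z.

Local Notation Er f := (Rintegral P setT f).
Local Notation integrable f := (P.-integrable setT (EFin \o f)).

(** The weight [q = N^(-(1 + eta)/2)] makes both [n p q^2] and [p q] at most [1]; the
moments provide [N^(-1/2)] instead, a loss of [N^(eta/2)] per edge.  The factor
[p] is at most [N^((1 + eta)/2)], and the gains are [N^(-1/2 - dl)]. *)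
Lemma expected_trace_rate (C dl eta s kap : R) (d0 : nat) :
  1 <= C -> (0 < d0)%N -> 1 <= d0%:R * dl -> 0 < dl -> dl <= 1 / 2 ->
  dl <= 2 * s - 1 / 2 -> 0 < eta -> 0 < s -> 0 < kap -> kap < 4 -> kap * s = 1 ->
  (forall (b : R) (m : nat), 1 <= b -> (0 < m)%N ->
    `|Er (fun w => truncate b (Z 0%N 0%N w) ^+ m)| <=
      C * (if (m == 1%N) || (kap <= m%:R) then b `^ (m%:R - kap) else 1)) ->
  exists2 M : R, 0 <= M & forall n p : nat,
    (0 < n)%N -> (0 < p)%N -> p%:R <= (n * p)%:R `^ ((1 + eta) / 2) :> R ->
    let F w := \tr (off_diag (truncated_matrix sigma Z ((n * p)%:R `^ s) p n w)
                      ^+ (2 * d0)) in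
    integrable F /\
    Er F <= M * (n * p)%:R `^ ((2 * (2 * d0))%:R * s + eta * (2 * d0)%:R + eta / 2 - dl).
Proof.
move=> C1 d00 d0dl dl0 dl_half dl_s eta0 s0 kap0 kap4 kaps HC.
set K := (2 * d0)%N.
pose Ms := (2 * K)%:R * Er (fun w => sigma 0%N 0%N w ^+ (2 * K)).
have Ms0 : 0 <= Ms.
  by rewrite mulr_ge0// Rintegral_ge0// => w _; exact: exprn_ge0.
pose cK : R := (\prod_(i < K) (4 * i + 1)%N)%:R.
have cK0 : 0 <= cK by exact: ler0n.
have CK0 : 0 <= C ^+ (2 * K) by apply: exprn_ge0; exact: le_trans C1.
exists (Ms * C ^+ (2 * K) * cK); first exact: (mulr_ge0 (mulr_ge0 Ms0 CK0) cK0).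
move=> n p n0 p0; set N : R := (n * p)%:R => pN F.
have N1 : 1 <= N by rewrite (ler_nat R 1) muln_gt0 n0.
have N0 : 0 < N by exact: lt_le_trans N1.
have le_exp u v : u <= v -> N `^ u <= N `^ v by move=> uv; exact: ler_powR.
have le1_exp u : 0 <= u -> 1 <= N `^ u by move=> u0; rewrite -[leLHS](powRr0 N) le_exp.
have ge1_exp u : u <= 0 -> N `^ u <= 1 by move=> u0; rewrite -[leRHS](powRr0 N) le_exp.
have [gD gH] := moment_gain_bounds N1 kap0 kap4 kaps dl_half dl_s.
pose q := N `^ (- ((1 + eta) / 2)).
have npq : n%:R * p%:R * q ^+ 2 <= 1.
  rewrite -natrM -/N /q powR_exprn -[X in X * _](powRr1 (ltW N0)) powR_addn//.
  by apply: ge1_exp; lra.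
have pq : p%:R * q <= 1 by rewrite /q powRN ler_pdivrMr ?powR_gt0// mul1r.
have q1 : q <= 1 by apply: ge1_exp; lra.
have qLam : N `^ (- (1 / 2)) <= q * N `^ (eta / 2).
  by rewrite /q powR_addn//; apply: le_exp; lra.
have Lam1 : 1 <= N `^ (eta / 2) by apply: le1_exp; lra.
have D1 : N `^ (- dl) <= 1 by apply: ge1_exp; lra.
have dD : (N `^ (- dl)) ^+ d0 <= N `^ (- (1 / 2)) * N `^ (- dl).
  rewrite powR_exprn powR_addn//; apply: le_exp; rewrite mulNr mulrC.
  by lra.
have dK : (3 * d0 <= 2 * K)%N by rewrite /K mulnA leq_mul2r orbT.
have Kgt0 : (0 < K)%N by rewrite muln_gt0.
have Ns1 : 1 <= N `^ s by exact: le1_exp (ltW s0).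
have HV m : (0 < m)%N -> `|Er (fun w => truncate (N `^ s) (Z 0%N 0%N w) ^+ m)| <=
    N `^ (- (1 / 2)) * C * (N `^ s) ^+ m * moment_gain N s kap m.
  move=> m0; apply: (le_trans (HC _ _ Ns1 m0)); rewrite /moment_gain.
  move: (if _ then _ else _) => v.
  rewrite (_ : _ * _ * _ * _ = C * v * (N `^ (- (1 / 2)) * N `^ (1 / 2)) *
     ((N `^ s) ^+ m / (N `^ s) ^+ m)); last by ring.
  rewrite powR_addn// addNr powRr0 mulr1 divff ?mulr1//.
  by rewrite expf_neq0// gt_eqF// powR_gt0.
have := expected_trace_le sigma_ge0 sigma_stationary sigma_moments Z_iid sigma_Z_indep
  (powR_ge0 N s) (powR_ge0 _ _) q1 npq pq (powR_ge0 _ _) qLam Lam1 (powR_ge0 N s) C1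
  (powR_ge0 _ _) D1 (powR_ge0 _ _) gD gH dD dK Kgt0 HV.
move=> [iF EF]; split=> //; apply: (le_trans EF); rewrite -/Ms -/cK !powR_exprn.
rewrite (_ : Ms * _ * _ = Ms * C ^+ (2 * K) * cK *
   (N `^ (s * (2 * K)%:R) * N `^ (eta / 2 * (2 * K)%:R) *
     (N `^ (- (1 / 2)) * N `^ (- dl)) * p%:R)); last by ring.
apply: ler_wpM2l; first exact: (mulr_ge0 (mulr_ge0 Ms0 CK0) cK0).
apply: (@le_trans _ _ (N `^ (s * (2 * K)%:R) * N `^ (eta / 2 * (2 * K)%:R) *
     (N `^ (- (1 / 2)) * N `^ (- dl)) * N `^ ((1 + eta) / 2))).
  by apply: ler_wpM2l => //; rewrite !mulr_ge0 ?powR_ge0.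
rewrite !powR_addn//; apply: le_exp; rewrite le_eqVlt; apply/orP; left; apply/eqP.
by rewrite natrM; move: (K%:R) => k; field.
Qed.

End TraceRate.

(** * The off-diagonal part is negligible *)

Theorem theorem2p1 (R : realType) (d : measure_display) (T : measurableType d)
  (P : probability T R)
  (sigma Z : nat -> nat -> {RV P >-> R})
  (Z_iid : iid_field Z)
  (sigma_ge0 : forall i t w, 0 <= sigma i t w)
  (sigma_stationary : strictly_stationary sigma)
  (sigma_Z_indep : independent_fields sigma Z)
  (a : nat -> R)
  (a_gt0 : forall k, (0 < k)%N -> 0 < a k)
  (a_tail : k%:R * fine (P [set w | a k < `|Z 0%N 0%N w|])
              @[k --> \oo] --> (1 : R))
  (p : nat -> nat) (beta : R) (ell : R -> R)
  (p_infty : p n @[n --> \oo] --> \oo)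
  (beta_gt0 : 0 < beta) (beta_le1 : beta <= 1)
  (ell_sv : slowly_varying ell)
  (p_form : forall n, (0 < n)%N -> (p n)%:R = n%:R `^ beta * ell n%:R)
  (alpha qp qm : R) (L : R -> R)
  (alpha_range : 0 < alpha < 2 \/ 2 < alpha < 4)
  (qp_ge0 : 0 <= qp) (qm_ge0 : 0 <= qm) (q_sum : qp + qm = 1)
  (L_sv : slowly_varying L)
  (right_tail : fine (P [set w | x < Z 0%N 0%N w]) / (L x * x `^ (- alpha))
                  @[x --> +oo] --> qp)
  (left_tail : fine (P [set w | Z 0%N 0%N w < - x]) / (L x * x `^ (- alpha))
                 @[x --> +oo] --> qm)
  (Z_centered : ('E_P[(fun w => `|Z 0%N 0%N w|%R)] < +oo)%E ->
                ('E_P[Z 0%N 0%N] = 0)%E)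
  (sigma_moments : forall r : R, 0 < r ->
     ('E_P[(fun w => sigma 0%N 0%N w `^ r)%R] < +oo)%E) :
  cvg_in_probability P
    (fun n w =>
       let X := sv_matrix sigma Z (p n) n w in
       let S := X *m X^T in
       (a (n * p n)%N ^+ 2)^-1 * spectral_norm (S - diag_part S))
    0.
Proof.
have [indZ idZ] := Z_iid.
have alpha0 : 0 < alpha by case: alpha_range => /andP[? ?] //; lra.
have alpha4 : alpha < 4 by case: alpha_range => /andP[? ?] //; lra.
have [d0 [dl [eta [s [r [kap [kap' [
  [d00 d0dl dl0 dl_half] [dl_s eta0 s0 r0 r_alpha] [kap0 kap4 kaps]
  [kk' k'alpha sk'] rate]]]]]]]] := exponent_choice alpha0 alpha4.
have tail : \forall x \near +oo, abs_tail (Z 0%N 0%N) x <= x `^ (- kap').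
  have e0 : 0 < alpha - kap' by rewrite subr_gt0.
  have := abs_tail_bounds q_sum L_sv right_tail left_tail e0.
  by apply: filterS => x /andP[_]; rewrite addKr.
have [C C1 HC] := truncated_moments kap0 (abs_moment_integrable kap0 kk' tail) Z_centered.
have [M M0 HM] := expected_trace_rate sigma_ge0 sigma_stationary sigma_moments Z_iid
  sigma_Z_indep C1 d00 d0dl dl0 dl_half dl_s eta0 s0 kap0 kap4 kaps HC.
set K := (2 * d0)%N in rate HM.
(* The decay rate of the probability of an exceedance of [N^s] among [N] variables. *)
pose gam1 := s * kap' - 1.
have gam10 : 0 < gam1 by rewrite subr_gt0.
(* The decay rate of the expected trace relative to [a_N^(2K)]. *)
pose gam2 := dl - ((2 * K)%:R * (s - r) + eta * K%:R + eta / 2).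
have gam20 : 0 < gam2 by rewrite subr_gt0.
have pgt0 : \forall n \near \oo, (0 < p n)%N.
  by apply: (p_infty [set m | (0 < m)%N]); exact: nbhs_infty_gt.
have nearN (Q : nat -> Prop) : (\forall k \near \oo, Q k) ->
    \forall n \near \oo, Q (n * p n)%N.
  move=> [m _ mQ]; have [m' _ Hm'] := pgt0.
  exists (maxn m m') => // n /=; rewrite geq_max => /andP[mn m'n].
  by apply: mQ => /=; rewrite (leq_trans mn)// leq_pmulr// Hm'.
have nearNR (Q : R -> Prop) : (\forall x \near +oo, Q x) ->
    \forall n \near \oo, Q (n * p n)%:R.
  by move=> HQ; exact: (nearN (fun k => Q k%:R) (near_natr HQ)).
have [X [_ HX]] := tail.
have growth_p := slowly_varying_growth beta_le1 ell_sv p_form eta0.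
have growth_a := nearN (fun k => k%:R `^ r <= a k)
  (quantile_growth q_sum L_sv right_tail left_tail a_tail r0 r_alpha).
have bigN := nearNR (fun x => X + 1 <= x `^ s) (powR_eventually_ge (X + 1) s0).
move=> e e0; apply: cvg_probability0 => [n|e' e'0]; first exact: measure_ge0.
have e'20 : 0 < e' / 2 by rewrite divr_gt0.
have small1 := nearNR (fun x => x `^ (- gam1) <= e' / 2)
  (powR_neg_eventually_le gam10 e'20).
have Me0 : 0 <= M / e ^+ K by rewrite divr_ge0// exprn_ge0// ltW.
have c20 : 0 < e' / 2 / (M / e ^+ K + 1) by rewrite divr_gt0// ltr_wpDl.
have small2 := nearNR (fun x => x `^ (- gam2) <= e' / 2 / (M / e ^+ K + 1))
  (powR_neg_eventually_le gam20 c20).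
near=> n.
have Xs : X + 1 <= (n * p n)%:R `^ s by near: n.
have aN : (n * p n)%:R `^ r <= a (n * p n)%N by near: n.
have N1small : (n * p n)%:R `^ (- gam1) <= e' / 2 by near: n.
have N2small : (n * p n)%:R `^ (- gam2) <= e' / 2 / (M / e ^+ K + 1) by near: n.
have pn : (p n)%:R <= n%:R `^ (1 + eta) :> R by near: n.
have n0 : (0 < n)%N by near: n; exact: nbhs_infty_gt.
have p0 : (0 < p n)%N by near: n.
have N0nat : (0 < n * p n)%N by rewrite muln_gt0 n0.
have [] := HM n (p n) n0 p0 (dimension_bound eta0 n0 p0 pn).
have aN0 : 0 < a (n * p n)%N by exact: a_gt0.
set N : R := (n * p n)%:R in Xs aN N1small N2small *.
have N0 : 0 < N by rewrite ltr0n.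
set F := fun w => _ => iF EF.
have y0 : 0 < e * a (n * p n)%N ^+ 2 by rewrite mulr_gt0// exprn_gt0.
apply: (@le_trans _ _ (P [set w | (e * a (n * p n)%N ^+ 2 <
    spectral_norm (off_diag (sv_matrix sigma Z (p n) n w)))%R])).
  have E w : (e < `|(a (n * p n)%N ^+ 2)^-1 *
        spectral_norm (off_diag (sv_matrix sigma Z (p n) n w)) - 0|) =
      (e * a (n * p n)%N ^+ 2 < spectral_norm (off_diag (sv_matrix sigma Z (p n) n w))).
    rewrite subr0 ger0_norm; first by rewrite mulrC ltr_pdivlMr// exprn_gt0.
    by rewrite mulr_ge0 ?spectral_norm_ge0// invr_ge0 exprn_ge0// ltW.
  rewrite le_eqVlt; apply/orP; left; apply/eqP; congr (P _).
  by apply/seteqP; split => w /=; rewrite -E.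
apply: (le_trans (off_diag_norm_tail idZ y0 iF)); rewrite lee_fin [leRHS]splitr.
apply: lerD.
  apply: le_trans N1small.
  apply: (@le_trans _ _ (N * (N `^ s) `^ (- kap'))).
    by apply: ler_wpM2l; [exact: ltW|apply: HX; apply: lt_le_trans Xs; rewrite ltrDl].
  rewrite -powRrM -[X in X * _](powRr1 (ltW N0)) powR_addn//.
  by rewrite /gam1 opprB mulrN.
apply: (@le_trans _ _ (M / e ^+ K * N `^ (- gam2))); last first.
  apply: (le_trans (ler_wpM2l Me0 N2small)).
  by rewrite mulrCA ger_pMr// ler_pdivrMr ?ltr_wpDl// mul1r lerDl.
rewrite ler_pdivrMr ?exprn_gt0// -/K exprMn.
have aK : N `^ (r * (2 * K)%:R) <= (a (n * p n)%N ^+ 2) ^+ K.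
  rewrite -powR_exprn -exprM; apply: lerXn2r; rewrite ?nnegrE ?powR_ge0//.
  exact: ltW.
rewrite (_ : M / e ^+ K * _ * _ =
    M * (N `^ (- gam2) * (a (n * p n)%N ^+ 2) ^+ K) * (e ^+ K / e ^+ K)); last by ring.
rewrite divff ?mulr1; last by rewrite expf_neq0// gt_eqF.
apply: (le_trans EF); apply: ler_wpM2l => //.
apply: (@le_trans _ _ (N `^ (- gam2) * N `^ (r * (2 * K)%:R))); last first.
  by apply: ler_wpM2l => //; exact: powR_ge0.
rewrite powR_addn// le_eqVlt; apply/orP; left; apply/eqP; congr (_ `^ _).
by rewrite /gam2; move: (_%:R) (_%:R) => u v; ring.
Unshelve. all: by end_near. Qed.
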